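(* Let $A\in\mathbb{R}^{n\times n}$, $B\in\mathbb{R}^{n\times m}$, let $Q\in\mathbb{R}^{n\times n}$ and $R\in\mathbb{R}^{m\times m}$ be positive definite, and let $\gamma>0$. Assume that the Riccati equation $$|x|^2_{P}=\min_u\max_v\left\{|x|_Q^2+|u|_R^2-\gamma^2|Ax+Bu-v|^2+|v|^2_{P}\right\}\quad\text{for all }x\in\mathbb{R}^n$$ has a solution $0\prec P\prec\gamma^2I$, with minimizing argument $u=-Kx$. Let $T:=Q+A^\top(P^{-1}-\gamma^{-2}I)^{-1}A$, and assume that $A$ and $T-P$ are invertible. Define $$\bar V_0(x,Z)=|x|_P^2-\gamma^2\min_{i=\pm1}\left\|\begin{bmatrix}I&iA\end{bmatrix}^\top\right\|_Z^2,\qquad \bar V_{k+1}(x,Z)=\mathcal{F}\bar V_k(x,Z),$$ with $\mathcal{F}$ the Bellman operator defined in the context. Then the following two conditions are equivalent: (i) The value of Problem I (defined in the context) is finite and $\bar V_k=\bar V_1$ for $k\ge1$. (ii) The matrix $T$ satisfies $$(\gamma^2I-P)(T-P)^{-1}(\gamma^2I-P)\succeq(I\pm BKA^{-1})(\gamma^2I-P)(I\pm BKA^{-1})^\top$$ for both the ''$+$'' and the ''$-$'' sign. Moreover, if (i) and (ii) hold, then Problem I has the minimizing control law $$u_t=\operatorname{sat}\left(\frac{\gamma^2\sum_{\tau=0}^{t-1}(Bu_\tau-x_{\tau+1})^\top Ax_\tau}{|x_t|^2_{T-P}}\right)Kx_t$$ and, with $Y:=\gamma^2\begin{bmatrix}I&0\end{bmatrix}Z\begin{bmatrix}0&I\end{bmatrix}^\top$,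 the limit $V_*=\lim_{k\to\infty}V_k$ (defined in the context) can be written as $$V_*(x,Z)=\begin{cases}|x|^2_{P}-\gamma^2\min_{i=\pm1}\left\|\begin{bmatrix}I&iA\end{bmatrix}^\top\right\|_Z^2&\text{if }|\langle A,Y\rangle|\ge|x|^2_{T-P},\\[1mm]|x|^2_{T}-\gamma^2\left\|\operatorname{diag}\{I,A\}^\top\right\|_Z^2+\langle A,Y\rangle^2|x|^{-2}_{T-P}&\text{otherwise.}\end{cases}$$
   Context: Notation: $|x|_M^2=x^\top Mx$, $|x|^2=x^\top x$, $|x|_M^{-2}=1/|x|_M^2$ for vectors; $\|N\|_M^2=\operatorname{trace}(N^\top MN)$ and $\langle M,N\rangle=\operatorname{trace}(M^\top N)$ for matrices. $\succ,\succeq$ denote the positive (semi-)definite order on symmetric matrices. $\operatorname{sat}(y)=1$ if $y>1$, $-1$ if $y<-1$, and $y$ otherwise. $I$ is the $n\times n$ identity; $\begin{bmatrix}I& iA\end{bmatrix}^\top$ is $2n\times n$ with blocks $I$ and $iA^\top$ ($i\in\{-1,1\}$ is a sign), $\operatorname{diag}\{I,A\}$ is $2n\times 2n$ block diagonal, and $\begin{bmatrix}I&0\end{bmatrix},\begin{bmatrix}0&I\end{bmatrix}$ are $n\times 2n$, so $Y$ is $\gamma^2$ times the upper right $n\times n$ block of $Z$. In the control law, $u_t=0$ when $x_t=0$. Problem I: for a given $x_0\in\mathbb{R}^n$, the value is $$\inf_\mu\sup_{w,i,N}\sum_{t=0}^N\left(|x_t|_Q^2+|u_t|_R^2-\gamma^2|w_t|^2\right),$$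 where $i\in\{-1,1\}$, $w_t\in\mathbb{R}^n$, $N\ge0$, and $x,u$ are generated by $x_{t+1}=iAx_t+Bu_t+w_t$ for $t\ge0$ and $u_t=\mu_t(x_0,\ldots,x_t,u_0,\ldots,u_{t-1})$; the infimum is over control laws $\mu=(\mu_t)_{t\ge0}$. ''The value is finite'' means finite for every $x_0$; a minimizing control law is one attaining the infimum for every $x_0$. Bellman operator: for a function $V(x,Z)$ of $x\in\mathbb{R}^n$ and positive semi-definite $Z\in\mathbb{R}^{2n\times2n}$, $$\mathcal{F}V(x,Z):=\min_{u\in\mathbb{R}^m}\max_{v\in\mathbb{R}^n}\left\{|x|_Q^2+|u|_R^2+V\left(v,\,Z+\begin{bmatrix}Bu-v\\ x\end{bmatrix}\begin{bmatrix}Bu-v\\ x\end{bmatrix}^\top\right)\right\},$$ where $\min$ and $\max$ are read as infimum and supremum with values in $\mathbb{R}\cup\{+\infty\}$ when they are not attained. The functions $V_k$ are defined by $V_0(x,Z)=-\gamma^2\min_{i=\pm1}\left\|\begin{bmatrix}I& iA\end{bmatrix}^\top\right\|^2_Z$ and $V_{k+1}=\mathcal{F}V_k$, and $V_*:=\lim_{k\to\infty}V_k$.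
   Formalization: In the ''Moreover'' part P is assumed to be the least solution of the Riccati equation with 0≺P≺γ²I; for an arbitrary solution the formula for V_* fails (n=m=1, γ=1, A²=21/32, B=1, R=2, Q=1/16 has solutions P=1/4 and P=1/2, both satisfying (ii)). *)

(* Defs.v *)
From mathcomp Require Import all_boot all_order all_algebra.
From mathcomp Require Import all_classical all_reals all_analysis.
Set Implicit Arguments.
Unset Strict Implicit.
Unset Printing Implicit Defensive.
Import Order.TTheory GRing.Theory Num.Theory.
Import numFieldNormedType.Exports.
Local Open Scope classical_set_scope.
Local Open Scope ring_scope.

(* Throughout, the control weight "R" of the mathematics is written [Rm], since
   [R] is the type of real numbers. *)

(* |x|_M^2 = x^T M x *)
Definition qnorm (R : realType) (n : nat) (M : 'M[R]_n) (x : 'cV[R]_n) : R :=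
  (x^T *m M *m x) 0 0.

(* |x|^2 = x^T x; the norm [`|x|] of the library is the sup norm. *)
Definition enorm2 (R : realType) (n : nat) (x : 'cV[R]_n) : R :=
  (x^T *m x) 0 0.

(* ||N||_M^2 = trace (N^T M N) *)
Definition mxnorm2 (R : realType) (p q : nat) (M : 'M[R]_p)
    (N : 'M[R]_(p, q)) : R :=
  \tr (N^T *m M *m N).

(* <M, N> = trace (M^T N) *)
Definition mxdot (R : realType) (p q : nat) (M N : 'M[R]_(p, q)) : R :=
  \tr (M^T *m N).

Definition posdef (R : realType) (n : nat) (M : 'M[R]_n) : Prop :=
  M^T = M /\ forall x : 'cV[R]_n, x != 0 -> 0 < qnorm M x.

Definition possemidef (R : realType) (n : nat) (M : 'M[R]_n) : Prop :=
  M^T = M /\ forall x : 'cV[R]_n, 0 <= qnorm M x.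

Definition sat (R : realType) (y : R) : R :=
  if 1 < y then 1 else if y < -1 then -1 else y.

(* max_v { |x|_Q^2 + |u|_R^2 - gamma^2 |Ax + Bu - v|^2 + |v|_P^2 } *)
Definition riccati_max (R : realType) (n m : nat) (A : 'M[R]_n)
    (B : 'M[R]_(n, m)) (Q : 'M[R]_n) (Rm : 'M[R]_m) (gamma : R) (P : 'M[R]_n)
    (x : 'cV[R]_n) (u : 'cV[R]_m) : \bar R :=
  ereal_sup [set (qnorm Q x + qnorm Rm u
                  - gamma ^+ 2 * enorm2 (A *m x + B *m u - v)
                  + qnorm P v)%:E | v in [set: 'cV[R]_n]].

Definition riccati (R : realType) (n m : nat) (A : 'M[R]_n)
    (B : 'M[R]_(n, m)) (Q : 'M[R]_n) (Rm : 'M[R]_m) (gamma : R)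
    (P : 'M[R]_n) : Prop :=
  forall x : 'cV[R]_n,
    (qnorm P x)%:E =
    ereal_inf [set riccati_max A B Q Rm gamma P x u | u in [set: 'cV[R]_m]].

(* A solution with 0 < P < gamma^2 I need not be unique: for n = m = 1,
   gamma = 1, A^2 = 21/32, B = 1, R = 2, Q = 1/16, both P = 1/4 and P = 1/2 are
   solutions (and T - P is invertible for both).  The value of the game with
   known sign i is given by the least solution only. *)
Definition least_riccati (R : realType) (n m : nat) (A : 'M[R]_n)
    (B : 'M[R]_(n, m)) (Q : 'M[R]_n) (Rm : 'M[R]_m) (gamma : R)
    (P : 'M[R]_n) : Prop :=
  forall P' : 'M[R]_n,
    posdef P' -> posdef ((gamma ^+ 2)%:M - P') ->
    riccati A B Q Rm gamma P' -> possemidef (P' - P).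

(* A control law: [mu t] maps (x_0, ..., x_t) and (u_0, ..., u_{t-1}) to u_t. *)
Definition control_law (R : realType) (n m : nat) : Type :=
  forall t : nat, t.+1.-tuple 'cV[R]_n -> t.-tuple 'cV[R]_m -> 'cV[R]_m.

(* The pair (x_0, ..., x_t), (u_0, ..., u_{t-1}) generated by
   x_{t+1} = i A x_t + B u_t + w_t. *)
Fixpoint history (R : realType) (n m : nat) (A : 'M[R]_n) (B : 'M[R]_(n, m))
    (mu : control_law R n m) (x0 : 'cV[R]_n) (i : R) (w : nat -> 'cV[R]_n)
    (t : nat) : t.+1.-tuple 'cV[R]_n * t.-tuple 'cV[R]_m :=
  match t with
  | 0 => ([tuple x0], [tuple])
  | t'.+1 =>
      let h := history A B mu x0 i w t' in
      let u := mu t' h.1 h.2 in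
      (rcons_tuple h.1 (i *: (A *m tnth h.1 ord_max) + B *m u + w t'),
       rcons_tuple h.2 u)
  end.

Definition state (R : realType) (n m : nat) (A : 'M[R]_n) (B : 'M[R]_(n, m))
    (mu : control_law R n m) (x0 : 'cV[R]_n) (i : R) (w : nat -> 'cV[R]_n)
    (t : nat) : 'cV[R]_n :=
  tnth (history A B mu x0 i w t).1 ord_max.

Definition input (R : realType) (n m : nat) (A : 'M[R]_n) (B : 'M[R]_(n, m))
    (mu : control_law R n m) (x0 : 'cV[R]_n) (i : R) (w : nat -> 'cV[R]_n)
    (t : nat) : 'cV[R]_m :=
  let h := history A B mu x0 i w t in mu t h.1 h.2.

Definition cost (R : realType) (n m : nat) (A : 'M[R]_n) (B : 'M[R]_(n, m))
    (Q : 'M[R]_n) (Rm : 'M[R]_m) (gamma : R) (mu : control_law R n m)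
    (x0 : 'cV[R]_n) (w : nat -> 'cV[R]_n) (i : R) (N : nat) : R :=
  \sum_(0 <= t < N.+1)
    (qnorm Q (state A B mu x0 i w t) + qnorm Rm (input A B mu x0 i w t)
     - gamma ^+ 2 * enorm2 (w t)).

Definition worst_cost (R : realType) (n m : nat) (A : 'M[R]_n)
    (B : 'M[R]_(n, m)) (Q : 'M[R]_n) (Rm : 'M[R]_m) (gamma : R)
    (mu : control_law R n m) (x0 : 'cV[R]_n) : \bar R :=
  ereal_sup [set J | exists (w : nat -> 'cV[R]_n) (i : R) (N : nat),
    (i = 1 \/ i = -1) /\ J = (cost A B Q Rm gamma mu x0 w i N)%:E].

Definition game_value (R : realType) (n m : nat) (A : 'M[R]_n)
    (B : 'M[R]_(n, m)) (Q : 'M[R]_n) (Rm : 'M[R]_m) (gamma : R)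
    (x0 : 'cV[R]_n) : \bar R :=
  ereal_inf [set worst_cost A B Q Rm gamma mu x0
            | mu in [set: control_law R n m]].

Definition minimizing_law (R : realType) (n m : nat) (A : 'M[R]_n)
    (B : 'M[R]_(n, m)) (Q : 'M[R]_n) (Rm : 'M[R]_m) (gamma : R)
    (mu : control_law R n m) : Prop :=
  forall x0 : 'cV[R]_n,
    worst_cost A B Q Rm gamma mu x0 = game_value A B Q Rm gamma x0.

(* Functions V(x, Z) are only meaningful for positive semi-definite Z; the
   operator below preserves this domain since Z + z z^T is positive
   semi-definite whenever Z is. *)
Definition bellman (R : realType) (n m : nat) (B : 'M[R]_(n, m))
    (Q : 'M[R]_n) (Rm : 'M[R]_m) (V : 'cV[R]_n -> 'M[R]_(n + n) -> \bar R)
    (x : 'cV[R]_n) (Z : 'M[R]_(n + n)) : \bar R :=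
  ereal_inf [set
    ereal_sup [set
      ((qnorm Q x + qnorm Rm u)%:E
       + V v (Z + col_mx (B *m u - v) x *m (col_mx (B *m u - v) x)^T)%R)%E
      | v in [set: 'cV[R]_n]]
    | u in [set: 'cV[R]_m]].

(* min_{i = +-1} || [I  iA]^T ||_Z^2 *)
Definition min_sign (R : realType) (n : nat) (A : 'M[R]_n)
    (Z : 'M[R]_(n + n)) : R :=
  Num.min (mxnorm2 Z (row_mx 1%:M (1 *: A))^T)
          (mxnorm2 Z (row_mx 1%:M ((-1) *: A))^T).

Definition V_iter (R : realType) (n m : nat) (A : 'M[R]_n) (B : 'M[R]_(n, m))
    (Q : 'M[R]_n) (Rm : 'M[R]_m) (gamma : R) (k : nat) :
    'cV[R]_n -> 'M[R]_(n + n) -> \bar R :=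
  iter k (bellman B Q Rm) (fun _ Z => (- (gamma ^+ 2 * min_sign A Z))%:E).

Definition Vbar_iter (R : realType) (n m : nat) (A : 'M[R]_n)
    (B : 'M[R]_(n, m)) (Q : 'M[R]_n) (Rm : 'M[R]_m) (gamma : R)
    (P : 'M[R]_n) (k : nat) : 'cV[R]_n -> 'M[R]_(n + n) -> \bar R :=
  iter k (bellman B Q Rm)
    (fun x Z => (qnorm P x - gamma ^+ 2 * min_sign A Z)%:E).

(* When x_t = 0 the quotient is y / 0 = 0, and u_t = 0 in any case. *)
Definition sat_law (R : realType) (n m : nat) (A : 'M[R]_n)
    (B : 'M[R]_(n, m)) (gamma : R) (K : 'M[R]_(m, n)) (D : 'M[R]_n) :
    control_law R n m :=
  fun t xs us =>
    let x (tau : nat) := nth 0 xs tau in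
    let u (tau : nat) := nth 0 us tau in
    sat (gamma ^+ 2 *
         (\sum_(0 <= tau < t)
            ((B *m u tau - x tau.+1)^T *m (A *m x tau)) 0 0)
         / qnorm D (x t))
    *: (K *m x t).

(* Y = gamma^2 [I 0] Z [0 I]^T *)
Definition Ymx (R : realType) (n : nat) (gamma : R) (Z : 'M[R]_(n + n)) :
    'M[R]_n :=
  gamma ^+ 2 *: (row_mx 1%:M 0 *m Z *m (row_mx 0 1%:M)^T).

(* Main.v *)
Require Import Defs.
From mathcomp Require Import all_boot all_order all_algebra.
From mathcomp Require Import all_classical all_reals all_analysis.
From mathcomp Require Import ring lra.
Import Order.TTheory GRing.Theory Num.Theory.
Import numFieldNormedType.Exports.
Local Open Scope classical_set_scope.
Local Open Scope ring_scope.

(** Write [y] for the correlation [<A, Y>], [c] for the energy common to both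
    signs, [M = gamma^2 I - P] and [D = T - P].  The value functions depend on
    [Z] only through [y] and [c], because
    [gamma^2 ||[I iA]^T||_Z^2 = gamma^2 c + 2 i y], and [c] merely shifts the
    value.  So [Vbar_0] is [|x|_P^2 + 2|y| - gamma^2 c], the maximum over the
    signs of the two games in which the sign is known.

    One Bellman step on it minimizes over [u] the maximum of two quadratic
    functions of [u], the costs of the known-sign games.  Completing squares, in
    the next state ([square_completion]) and in the control ([rcostE]), turns
    the Riccati equation into [K = gain P] and [|x|_D^2 = |Kx|_G^2] with [G] the
    weight of the control.  The minimizer is [sat(y / |x|_D^2) K x], and the
    value is the Huber function of [y] called [saturated] below
    ([bellman_sign_value]).

    The Huber function is the maximum over [t] in [-1, 1] of
    [2 t y - t^2 |x|_D^2].  In the second Bellman step the adversary therefore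
    chooses a next state and a number [t], a bet on a sign of mean [t].
    The bets [t = 1] and [t = -1] are those of the first step; the gain from
    another one is measured by the variance [1 - t^2] ([stage_mixE]), and
    requiring that it never exceeds the loss is a family of inequalities
    between quadratic forms ([mix_bound]).  The matrix inequalities of the
    statement imply all of them by convexity and duality
    ([matrix_condition_mix_bound]), and they are recovered from bets tending to
    a sure one ([mix_bound_matrix_condition]).  Necessity also uses that almost
    optimal controls of the second step are close to the minimizer of the first
    ([optimal_control_limit]).  This gives the equivalence, finiteness of the
    value being a consequence of the bound [worst_cost_law] on the saturated
    law.

    For the last part, [V_k] is at most [Vbar_k].  In the other direction, an
    adversary who commits to a sign reduces [V_k] to the Riccati iteration
    from [0] ([V_ge_riccati_iter]), which increases to a solution of the Riccati
    equation ([riccati_iter_cvg]); this solution is [P] when [P] is the least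
    one, and one more Bellman step gives the saturated value in the limit
    ([V_eventually_ge]).  Against any control law the adversary secures every
    [V_k] with [k >= 1] by playing nearly maximizing next states and choosing
    the sign at the end ([worst_cost_ge]), so no law does better than the
    saturated one. *)

(** * Quadratic forms *)

Section QuadraticForms.
Local Set Implicit Arguments.
Local Unset Strict Implicit.
Variable R : realType.

Definition dot (n : nat) (x y : 'cV[R]_n) : R := (x^T *m y) 0 0.

Lemma dotE n (x y : 'cV[R]_n) : dot x y = \sum_i x i 0 * y i 0.
Proof. by rewrite /dot mxE; apply: eq_bigr => i _; rewrite mxE. Qed.

Lemma dotC n (x y : 'cV[R]_n) : dot x y = dot y x.
Proof. by rewrite !dotE; apply: eq_bigr => i _; rewrite mulrC. Qed.

Lemma dotDl n (x y z : 'cV[R]_n) : dot (x + y) z = dot x z + dot y z.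
Proof. by rewrite /dot linearD mulmxDl mxE. Qed.

Lemma dotDr n (x y z : 'cV[R]_n) : dot z (x + y) = dot z x + dot z y.
Proof. by rewrite /dot mulmxDr mxE. Qed.

Lemma dotNl n (x z : 'cV[R]_n) : dot (- x) z = - dot x z.
Proof. by rewrite /dot linearN mulNmx mxE. Qed.

Lemma dotNr n (x z : 'cV[R]_n) : dot z (- x) = - dot z x.
Proof. by rewrite /dot mulmxN mxE. Qed.

Lemma dotZl n (a : R) (x z : 'cV[R]_n) : dot (a *: x) z = a * dot x z.
Proof. by rewrite /dot linearZ -scalemxAl mxE. Qed.

Lemma dotZr n (a : R) (x z : 'cV[R]_n) : dot z (a *: x) = a * dot z x.
Proof. by rewrite /dot -scalemxAr mxE. Qed.

Lemma dot0l n (z : 'cV[R]_n) : dot 0 z = 0.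
Proof. by rewrite /dot linear0 mul0mx mxE. Qed.

Lemma dot_mull n p (X : 'M[R]_(n, p)) x y :
  dot (X *m x) y = dot x (X^T *m y).
Proof. by rewrite /dot trmx_mul mulmxA. Qed.

Lemma dot_ge0 n (x : 'cV[R]_n) : 0 <= dot x x.
Proof. by rewrite dotE; apply: sumr_ge0 => i _; rewrite -expr2 sqr_ge0. Qed.

Lemma qnormE n (M : 'M[R]_n) x : qnorm M x = dot x (M *m x).
Proof. by rewrite /qnorm /dot mulmxA. Qed.

Lemma enorm2E n (x : 'cV[R]_n) : enorm2 x = dot x x.
Proof. by []. Qed.

Lemma qnormDm n (M N : 'M[R]_n) x : qnorm (M + N) x = qnorm M x + qnorm N x.
Proof. by rewrite !qnormE mulmxDl dotDr. Qed.

Lemma qnormNm n (M : 'M[R]_n) x : qnorm (- M) x = - qnorm M x.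
Proof. by rewrite !qnormE mulNmx dotNr. Qed.

Lemma qnormBm n (M N : 'M[R]_n) x : qnorm (M - N) x = qnorm M x - qnorm N x.
Proof. by rewrite qnormDm qnormNm. Qed.

Lemma qnormZm n a (M : 'M[R]_n) x : qnorm (a *: M) x = a * qnorm M x.
Proof. by rewrite !qnormE -scalemxAl dotZr. Qed.

Lemma qnorm_scalar n (a : R) (x : 'cV[R]_n) : qnorm a%:M x = a * dot x x.
Proof. by rewrite qnormE mul_scalar_mx dotZr. Qed.

Lemma qnormZ n (M : 'M[R]_n) a x : qnorm M (a *: x) = a ^+ 2 * qnorm M x.
Proof. by rewrite !qnormE -scalemxAr dotZl dotZr mulrA. Qed.

Lemma qnormN n (M : 'M[R]_n) x : qnorm M (- x) = qnorm M x.
Proof. by rewrite !qnormE mulmxN dotNl dotNr opprK. Qed.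

Lemma qnorm0 n (M : 'M[R]_n) : qnorm M 0 = 0.
Proof. by rewrite qnormE dot0l. Qed.

Lemma qnorm_congr n p (M : 'M[R]_n) (X : 'M[R]_(n, p)) x :
  qnorm (X^T *m M *m X) x = qnorm M (X *m x).
Proof. by rewrite !qnormE dot_mull !mulmxA. Qed.

Lemma qnormC n (M : 'M[R]_n) (x y : 'cV[R]_n) :
  M^T = M -> dot x (M *m y) = dot y (M *m x).
Proof. by move=> sM; rewrite -{1}sM -dot_mull dotC. Qed.

Lemma qnormD n (M : 'M[R]_n) (x y : 'cV[R]_n) : M^T = M ->
  qnorm M (x + y) = qnorm M x + 2 * dot x (M *m y) + qnorm M y.
Proof.
move=> sM; rewrite !qnormE mulmxDr !dotDl !dotDr (qnormC y x sM); ring.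
Qed.

Lemma posdef_ge0 n (M : 'M[R]_n) x : posdef M -> 0 <= qnorm M x.
Proof.
move=> [_ h]; have [->|x0] := eqVneq x 0; first by rewrite qnorm0.
exact/ltW/h.
Qed.

Lemma posdef_psd n (M : 'M[R]_n) : posdef M -> possemidef M.
Proof. by move=> h; split; [case: h|move=> x; apply: posdef_ge0]. Qed.

Lemma posdef_eq0 n (M : 'M[R]_n) x : posdef M -> qnorm M x <= 0 -> x = 0.
Proof.
move=> [_ h] q; apply/eqP/negPn/negP => /h; rewrite ltNge; exact/negP/negPn.
Qed.

Lemma posdefD n (M N : 'M[R]_n) : posdef M -> possemidef N -> posdef (M + N).
Proof.
move=> [sM pM] [sN pN]; split; first by rewrite linearD /= sM sN.
by move=> x x0; rewrite qnormDm ltr_wpDr ?pN ?pM.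
Qed.

Lemma posdef_unit n (M : 'M[R]_n) : posdef M -> M \in unitmx.
Proof.
move=> pM; rewrite -row_free_unit -kermx_eq0; apply/rowV0P => v /sub_kermxP vM.
have : qnorm M v^T <= 0 by rewrite /qnorm trmxK vM mul0mx mxE.
by move=> /(posdef_eq0 pM) v0; rewrite -(trmxK v) v0 trmx0.
Qed.

Lemma qnorm_inv n (M : 'M[R]_n) x :
  M^T = M -> M \in unitmx -> qnorm M (invmx M *m x) = qnorm (invmx M) x.
Proof. by move=> sM uM; rewrite !qnormE mulKVmx // dotC. Qed.

Lemma posdef1 n : posdef (1%:M : 'M[R]_n).
Proof.
split=> [|w w0]; first by rewrite trmx1.
rewrite qnorm_scalar mul1r lt_def dot_ge0 andbT; apply: contra w0.
rewrite dotE psumr_eq0 => [/allP h|i _]; last by rewrite -expr2 sqr_ge0.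
apply/eqP/matrixP => i j; rewrite ord1 mxE; apply/eqP.
by have := h i (mem_index_enum _); rewrite /= mulf_eq0 orbb.
Qed.

(** The sum of the moduli of the entries, a matrix norm that bounds the
    quadratic form and vanishes in an entrywise limit. *)
Definition entrynorm n (M : 'M[R]_n) : R := \sum_i \sum_j `|M i j|.

Lemma entrynorm_ge0 n (M : 'M[R]_n) : 0 <= entrynorm M.
Proof. by apply: sumr_ge0 => i _; apply: sumr_ge0. Qed.

Lemma qnorm_le_entrynorm n (M : 'M[R]_n) x :
  qnorm M x <= entrynorm M * dot x x.
Proof.
rewrite qnormE dotE /entrynorm mulr_suml; apply: ler_sum => i _.
rewrite mxE mulr_sumr mulr_suml; apply: ler_sum => j _.
rewrite mulrCA; apply: (le_trans (ler_norm _)); rewrite normrM.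
apply: ler_wpM2l => //.
have sq k : x k 0 ^+ 2 <= dot x x.
  rewrite dotE (bigD1 k) //= -expr2 lerDl; apply: sumr_ge0 => l _.
  by rewrite -expr2 sqr_ge0.
have := sq i; have := sq j; rewrite -(real_normK (num_real (x i 0))).
rewrite -(real_normK (num_real (x j 0))) normrM => h1 h2.
have := sqr_ge0 (`|x i 0| - `|x j 0|); nra.
Qed.

(** Expanding [0 <= |t M^-1 y - y|_M^2] bounds [|y|^2] by [|y|_M^2] once [t] is
    so small that [t |y|_(M^-1)^2 <= |y|^2]; this gives the constant without
    compactness of the sphere. *)
Lemma posdef_dominates n (M : 'M[R]_n) : posdef M ->
  exists2 C : R, 0 <= C & forall y, dot y y <= C * qnorm M y.
Proof.
move=> pM; have uM := posdef_unit pM.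
pose c := entrynorm (invmx M); have c0 : 0 <= c by apply: entrynorm_ge0.
exists (c + 1) => [|y]; first by rewrite addr_ge0.
pose t := (c + 1)^-1; have tc : t * (c + 1) = 1.
  by rewrite mulVf // gt_eqF // ltr_pwDr.
have t0 : 0 < t by rewrite invr_gt0 ltr_pwDr.
have := posdef_ge0 (y - t *: (invmx M *m y)) pM.
rewrite qnormD; last by case: pM.
rewrite qnormN qnormZ qnorm_inv //; last by case: pM.
rewrite mulmxN -scalemxAr mulKVmx // dotNr dotZr => h.
have q := qnorm_le_entrynorm (invmx M) y; rewrite -/c in q.
have d0 := dot_ge0 y.
have h2 : t * qnorm (invmx M) y <= dot y y.
  apply: (le_trans (ler_wpM2l (ltW t0) q)); rewrite mulrA ler_piMl //.
  by rewrite -tc; apply: ler_wpM2l; rewrite ?ltW // ltrDl.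
rewrite -(ler_pM2l t0) mulrA tc mul1r; nra.
Qed.

(** Hypothesis and conclusion say that [N^(1/2) W M^(1/2)] and its transpose are
    contractions.  Young's inequality at [x = M W^T p] avoids the square
    roots. *)
Lemma contraction_dual n (M N W : 'M[R]_n) : posdef M -> posdef N ->
  (forall x, qnorm N (W *m x) <= qnorm (invmx M) x) ->
  forall p, qnorm M (W^T *m p) <= qnorm (invmx N) p.
Proof.
move=> pM pN h p; have uN := posdef_unit pN; have uM := posdef_unit pM.
set q := M *m (W^T *m p).
have := h q; rewrite /q -(qnorm_inv (M *m _)) ?mulKmx //; last by case: pM.
have := posdef_ge0 (invmx N *m p - W *m q) pN; case: (pN) => sN _.
rewrite qnormD // qnormN qnorm_inv // mulmxN dotNr (qnormC _ _ sN) mulKVmx //.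
rewrite dot_mull dotC -qnormE -/q; lra.
Qed.

End QuadraticForms.

(** * Maximization over the next state *)

Section WorstState.
Local Set Implicit Arguments.
Local Unset Strict Implicit.
Variables (R : realType) (n : nat) (gamma : R).
Hypothesis gamma0 : 0 < gamma.
Implicit Types (P M : 'M[R]_n) (z v x : 'cV[R]_n).

Definition gap P : 'M[R]_n := (gamma ^+ 2)%:M - P.

Definition worst_state P z : 'cV[R]_n := gamma ^+ 2 *: (invmx (gap P) *m z).

(** The matrix [(P^-1 - gamma^-2 I)^-1], in a form that makes sense for singular
    [P]; it represents [z |-> max_v (|v|_P^2 - gamma^2 |z - v|^2)]. *)
Definition supmx P : 'M[R]_n := gamma ^+ 4 *: invmx (gap P) - (gamma ^+ 2)%:M.

Lemma gap_sym P : P^T = P -> (gap P)^T = gap P.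
Proof. by move=> sP; rewrite /gap linearB /= tr_scalar_mx sP. Qed.

Lemma supmx_sym P : P^T = P -> (supmx P)^T = supmx P.
Proof.
move=> sP.
by rewrite /supmx linearB /= linearZ /= trmx_inv gap_sym // tr_scalar_mx.
Qed.

Lemma supmxE P : P \in unitmx -> gap P \in unitmx ->
  invmx (invmx P - (gamma ^- 2)%:M) = supmx P.
Proof.
move=> uP uM; set X := invmx P - _.
have g2 : gamma ^+ 2 != 0 by rewrite expf_neq0 // gt_eqF.
have XM : X = gamma ^- 2 *: (invmx P *m gap P).
  rewrite /X /gap mulmxBr mulVmx // scalerBr mul_mx_scalar scalerA mulVf //.
  by rewrite scale1r scale_scalar_mx mulr1.
have h : X *m supmx P = 1%:M.
  rewrite /supmx mulmxBr -scalemxAr {1}XM -scalemxAl -mulmxA mulmxV // mulmx1.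
  rewrite scalerA mul_mx_scalar /X scalerBr scale_scalar_mx divff //.
  rewrite -[gamma ^+ 4]/(gamma ^+ (2 + 2)) exprD mulfK //.
  by rewrite opprB addrCA subrr addr0.
by have [uX _] := mulmx1_unit h; rewrite -[LHS]mulmx1 -h mulKmx.
Qed.

Lemma square_completion P z v : P^T = P -> gap P \in unitmx ->
  qnorm P v - gamma ^+ 2 * enorm2 (z - v) =
  qnorm (supmx P) z - qnorm (gap P) (v - worst_state P z).
Proof.
move=> sP uM; have sM := gap_sym sP.
have -> : qnorm P v = gamma ^+ 2 * dot v v - qnorm (gap P) v.
  by rewrite /gap qnormBm qnorm_scalar; ring.
rewrite qnormD // qnormN /worst_state qnormZ qnorm_inv // /supmx.
rewrite (qnormBm (_ *: _)) qnormZm qnorm_scalar mulmxN -scalemxAr mulKVmx // enorm2E.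
rewrite dotNr dotZr !(dotDl, dotDr, dotNl, dotNr) (dotC z v); ring.
Qed.

Lemma supmx_ge P z v : P^T = P -> posdef (gap P) ->
  qnorm P v - gamma ^+ 2 * enorm2 (z - v) <= qnorm (supmx P) z.
Proof.
move=> sP pM; rewrite square_completion ?posdef_unit //.
by rewrite lerBlDr lerDl posdef_ge0.
Qed.

Lemma supmx_attained P z : P^T = P -> posdef (gap P) ->
  qnorm P (worst_state P z) - gamma ^+ 2 * enorm2 (z - worst_state P z) =
  qnorm (supmx P) z.
Proof.
by move=> sP pM; rewrite square_completion ?posdef_unit // subrr qnorm0 subr0.
Qed.

Lemma supmx_ge_self P z : P^T = P -> posdef (gap P) ->
  qnorm P z <= qnorm (supmx P) z.
Proof.
move=> sP pM; apply: le_trans (supmx_ge z z sP pM).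
by rewrite subrr enorm2E dot0l mulr0 subr0.
Qed.

Lemma supmx_mono P1 P2 z : P1^T = P1 -> P2^T = P2 ->
  posdef (gap P1) -> posdef (gap P2) ->
  (forall x, qnorm P1 x <= qnorm P2 x) ->
  qnorm (supmx P1) z <= qnorm (supmx P2) z.
Proof.
move=> s1 s2 p1 p2 le12; rewrite -(supmx_attained z s1 p1).
by apply: le_trans (supmx_ge z (worst_state P1 z) s2 p2); rewrite lerD2r.
Qed.

(** Relative lower semicontinuity of [supmx] at a positive definite [P]: a
    relative rather than an absolute error passes directly through the
    minimization over the control. *)
Lemma supmx_continuous P : posdef P -> posdef (gap P) ->
  exists2 C : R, 0 <= C & forall P' (e : R), 0 <= e -> P'^T = P' -> posdef (gap P') ->
    (forall x, qnorm P x - e * dot x x <= qnorm P' x) ->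
    forall z, (1 - C * e) * qnorm (supmx P) z <= qnorm (supmx P') z.
Proof.
move=> pP pM; have [C1 C10 hC1] := posdef_dominates pP.
have sP : P^T = P by case: pP.
pose C2 := gamma ^+ 4 * entrynorm ((invmx (gap P))^T *m invmx (gap P)).
have C20 : 0 <= C2 by apply: mulr_ge0; [apply/exprn_ge0/ltW|apply: entrynorm_ge0].
exists (C2 * C1) => [|P' e e0 sP' pM' hP' z]; first by rewrite mulr_ge0.
apply: le_trans (supmx_ge z (worst_state P z) sP' pM').
have := supmx_attained z sP pM; have := hP' (worst_state P z).
suff : dot (worst_state P z) (worst_state P z) <=
       C2 * C1 * qnorm (supmx P) z by move/(ler_wpM2l e0); nra.
have -> : dot (worst_state P z) (worst_state P z) =
    gamma ^+ 4 * qnorm ((invmx (gap P))^T *m invmx (gap P)) z.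
  by rewrite /worst_state dotZl dotZr dot_mull qnormE mulmxA; ring.
rewrite /C2 -(mulrA _ _ C1) -mulrA; apply: ler_wpM2l; first by apply/exprn_ge0/ltW.
rewrite -mulrA; apply: le_trans (qnorm_le_entrynorm _ _) _.
apply: ler_wpM2l; first exact: entrynorm_ge0.
apply: le_trans (hC1 z) _; apply: ler_wpM2l => //; exact: supmx_ge_self.
Qed.

End WorstState.

(** * Riccati recursion *)

Section RiccatiRecursion.
Local Set Implicit Arguments.
Local Unset Strict Implicit.
Variables (R : realType) (n m : nat) (A : 'M[R]_n) (B : 'M[R]_(n, m)).
Variables (Q : 'M[R]_n) (Rm : 'M[R]_m) (gamma : R).
Hypotheses (gamma0 : 0 < gamma) (hQ : posdef Q) (hR : posdef Rm).
Local Notation gap := (gap gamma).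
Local Notation supmx := (supmx gamma).
Implicit Types (P : 'M[R]_n) (x : 'cV[R]_n) (u : 'cV[R]_m).

Definition rcost P x u : R :=
  qnorm Q x + qnorm Rm u + qnorm (supmx P) (A *m x + B *m u).

Definition control_weight P : 'M[R]_m := Rm + B^T *m supmx P *m B.

Definition gain P : 'M[R]_(m, n) :=
  invmx (control_weight P) *m (B^T *m supmx P *m A).

Definition ric P : 'M[R]_n :=
  Q + A^T *m supmx P *m A - (gain P)^T *m control_weight P *m gain P.

Lemma riccati_maxE P x u : P^T = P -> posdef (gap P) ->
  riccati_max A B Q Rm gamma P x u = (rcost P x u)%:E.
Proof.
move=> sP pM; apply/eqP; rewrite eq_le; apply/andP; split.
  apply: ge_ereal_sup => _ [v _ <-]; rewrite lee_fin /rcost.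
  by have := supmx_ge (A *m x + B *m u) v sP pM; lra.
apply: ereal_sup_ubound; exists (worst_state gamma P (A *m x + B *m u)) => //.
congr (_%:E); rewrite /rcost.
by have := supmx_attained (A *m x + B *m u) sP pM; lra.
Qed.

Section OneStep.
Variable P : 'M[R]_n.
Hypotheses (psdP : possemidef P) (pM : posdef (gap P)).

Lemma supmx_psd : possemidef (supmx P).
Proof.
case: psdP => sP gP; split=> [|x]; first exact: supmx_sym.
by apply: le_trans (gP x) _; apply: supmx_ge_self.
Qed.

Lemma control_weight_posdef : posdef (control_weight P).
Proof.
apply: posdefD => //; case: supmx_psd => sS gS; split=> [|u].
  by rewrite !trmx_mul trmxK sS mulmxA.
by rewrite qnorm_congr.
Qed.

Lemma gain_weight : control_weight P *m gain P = B^T *m supmx P *m A.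
Proof. by rewrite mulKVmx // posdef_unit //; apply: control_weight_posdef. Qed.

(** The cost is a square in [u] completed at [- gain P *m x], so that [ric P] is
    the value of the minimization over the control. *)
Lemma rcostE x u :
  rcost P x u = qnorm (ric P) x + qnorm (control_weight P) (u + gain P *m x).
Proof.
case: control_weight_posdef => sG _; case: supmx_psd => sS _.
have ricE : qnorm (ric P) x = qnorm Q x + qnorm (supmx P) (A *m x)
    - qnorm (control_weight P) (gain P *m x).
  by rewrite /ric qnormBm qnormDm !qnorm_congr.
have weightE : qnorm (control_weight P) u = qnorm Rm u + qnorm (supmx P) (B *m u).
  by rewrite /control_weight qnormDm qnorm_congr.
rewrite qnormD // mulmxA gain_weight ricE weightE /rcost qnormD //.
rewrite (qnormC _ _ sS) dot_mull !mulmxA; ring.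
Qed.

Lemma ric_le x u : qnorm (ric P) x <= rcost P x u.
Proof. by rewrite rcostE lerDl posdef_ge0 //; apply: control_weight_posdef. Qed.

Lemma ric_attained x : rcost P x (- (gain P *m x)) = qnorm (ric P) x.
Proof. by rewrite rcostE addNr qnorm0 addr0. Qed.

Lemma ric_ge_Q x : qnorm Q x <= qnorm (ric P) x.
Proof.
rewrite -ric_attained /rcost -addrA lerDl addr_ge0 //; first exact: posdef_ge0.
by case: supmx_psd.
Qed.

Lemma ric_psd : possemidef (ric P).
Proof.
split=> [|x]; last by apply: le_trans (ric_ge_Q x); apply: posdef_ge0.
case: control_weight_posdef => sG _; case: supmx_psd => sS _; case: hQ => sQ _.
by rewrite /ric linearB linearD /= !trmx_mul !trmxK sQ sS sG !mulmxA.
Qed.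

Lemma ric_inf x :
  ereal_inf [set riccati_max A B Q Rm gamma P x u | u in [set: 'cV[R]_m]] =
  (qnorm (ric P) x)%:E.
Proof.
case: psdP => sP _; apply/eqP; rewrite eq_le; apply/andP; split.
  apply: ereal_inf_lbound; exists (- (gain P *m x)) => //.
  by rewrite riccati_maxE // ric_attained.
by apply: le_ereal_inf_tmp => _ [u _ <-]; rewrite riccati_maxE // lee_fin ric_le.
Qed.

End OneStep.

Lemma ric_mono P1 P2 x : possemidef P1 -> possemidef P2 ->
  posdef (gap P1) -> posdef (gap P2) ->
  (forall x, qnorm P1 x <= qnorm P2 x) -> qnorm (ric P1) x <= qnorm (ric P2) x.
Proof.
move=> s1 s2 p1 p2 le12; rewrite -(ric_attained s2 p2).
apply: le_trans (ric_le s1 p1 x (- (gain P2 *m x))) _.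
by rewrite /rcost lerD2l supmx_mono //; [case: s1|case: s2].
Qed.

End RiccatiRecursion.

(** * Limit of the Riccati iterates *)

Section RiccatiLimit.
Local Set Implicit Arguments.
Local Unset Strict Implicit.
Variable R : realType.

Lemma le_forall_eps (a b c : R) :
  (forall e, 0 < e -> e <= 1 -> a <= b + c * e) -> a <= b.
Proof.
move=> h; apply/ler_addgt0Pr => e e0.
pose c' := `|c| + 1; have c'0 : 0 < c' by rewrite ltr_pwDr.
have ec : 0 < Num.min 1 (e / c') by rewrite lt_min ltr01 divr_gt0.
apply: le_trans (h _ ec _) _; first by rewrite ge_min lexx.
rewrite lerD2l; apply: (@le_trans _ _ (c' * Num.min 1 (e / c'))).
  by apply: ler_wpM2r; [exact: ltW|apply: le_trans (ler_norm c) _; rewrite lerDl].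
by rewrite mulrC -ler_pdivlMr // ge_min lexx orbT.
Qed.

Lemma absorb_relative_error (a b c r : R) :
  (1 - r) * c <= b -> a <= c -> 0 <= b -> 0 <= a -> a <= b + r * a.
Proof.
by move=> h1 h2 b0 a0; have [r1|/ltW r1] := leP r 1; nra.
Qed.

Lemma dot_delta n (M : 'M[R]_n) i j :
  dot (delta_mx i 0) (M *m delta_mx j 0) = M i j.
Proof. by rewrite /dot trmx_delta -colE -rowE !mxE. Qed.

(** Polarization reduces the entrywise limit to scalar monotone limits. *)
Lemma monotone_qnorm_cvg n (M_ : nat -> 'M[R]_n) (b : 'M[R]_n) :
  (forall k, (M_ k)^T = M_ k) ->
  (forall k x, qnorm (M_ k) x <= qnorm (M_ k.+1) x) ->
  (forall k x, qnorm (M_ k) x <= qnorm b x) ->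
  exists M : 'M[R]_n, M^T = M /\
    forall e : R, 0 < e -> exists N, forall k, (N <= k)%N -> forall x,
      `|qnorm M x - qnorm (M_ k) x| <= e * dot x x.
Proof.
move=> sM incM bM.
have cv x : cvgn (fun k => qnorm (M_ k) x).
  apply: nondecreasing_is_cvgn; first by apply/nondecreasing_seqP => k.
  by exists (qnorm b x) => _ [k _ <-].
pose d i : 'cV[R]_n := delta_mx i 0.
have entry k i j : M_ k i j = 2^-1 * (qnorm (M_ k) (d i + d j)
    - qnorm (M_ k) (d i) - qnorm (M_ k) (d j)).
  by rewrite qnormD // dot_delta; field.
have cve i j : cvgn (fun k => M_ k i j).
  rewrite (_ : (fun k => _) = (fun k => 2^-1 * (qnorm (M_ k) (d i + d j)
    - qnorm (M_ k) (d i) - qnorm (M_ k) (d j)))); last exact/funext.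
  by apply: is_cvgMr; apply: is_cvgB => //; apply: is_cvgB.
exists (\matrix_(i, j) limn (fun k => M_ k i j)); split.
  apply/matrixP => i j; rewrite !mxE; congr (lim (_ @ \oo)).
  by apply/funext => k; rewrite -{1}(sM k) mxE.
move=> e e0; set M := \matrix_(_, _) _.
pose e' := e / (n * n).+1%:R; have e'0 : 0 < e' by rewrite divr_gt0.
have : \forall k \near \oo, forall i, forall j, `|M i j - M_ k i j| <= e'.
  apply: filter_forall => i; apply: filter_forall => j; rewrite mxE.
  by move/cvgrPdist_le : (cve i j); apply.
case=> N _ hN; exists N => k Nk x.
suff le_e : entrynorm (M - M_ k) <= e.
  have d0 := dot_ge0 x; rewrite -qnormBm ler_norml; apply/andP; split.
    rewrite lerNl -qnormNm; apply: le_trans (qnorm_le_entrynorm _ _) _.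
    apply: ler_wpM2r => //; apply: le_trans le_e.
    by apply: ler_sum => i _; apply: ler_sum => j _; rewrite mxE normrN.
  by apply: le_trans (qnorm_le_entrynorm _ _) _; apply: ler_wpM2r.
apply: (@le_trans _ _ (\sum_(i < n) \sum_(j < n) e')).
  apply: ler_sum => i _; apply: ler_sum => j _; rewrite !mxE.
  by have := hN k Nk i j; rewrite mxE.
rewrite !sumr_const !card_ord -mulrnA -[leLHS]mulr_natr /e' mulrAC.
by rewrite ler_pdivrMr ?ltr0n // ler_wpM2l ?ltW // ltr_nat.
Qed.

Variables (n m : nat) (A : 'M[R]_n) (B : 'M[R]_(n, m)).
Variables (Q : 'M[R]_n) (Rm : 'M[R]_m) (gamma : R).
Hypotheses (gamma0 : 0 < gamma) (hQ : posdef Q) (hR : posdef Rm).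
Local Notation gap := (gap gamma).
Local Notation ric := (ric A B Q Rm gamma).
Local Notation rcost := (rcost A B Q Rm gamma).

Definition riccati_iter k : 'M[R]_n := iter k ric 0.

Lemma gap_posdef_le (P P' : 'M[R]_n) : P'^T = P' ->
  (forall x, qnorm P' x <= qnorm P x) -> posdef (gap P) -> posdef (gap P').
Proof.
move=> sP' le_P [_ pM]; split; first exact: gap_sym.
by move=> x /pM; rewrite /gap !qnormBm => h; apply: lt_le_trans h _; rewrite lerB.
Qed.

Section Bounded.
Variable P : 'M[R]_n.
Hypotheses (pP : posdef P) (pM : posdef (gap P)).
Hypothesis fixP : forall x, qnorm (ric P) x = qnorm P x.

Lemma riccati_iter_bounds k :
  possemidef (riccati_iter k) /\
  forall x, qnorm (riccati_iter k) x <= qnorm P x.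
Proof.
elim: k => [|k [psd le_P]].
  have z x : qnorm (0 : 'M[R]_n) x = 0 by rewrite qnormE mul0mx dotC dot0l.
  split=> [|x]; last by rewrite z posdef_ge0.
  by split=> [|x]; rewrite ?trmx0 ?z.
have pk : posdef (gap (riccati_iter k)) by apply: gap_posdef_le pM; case: psd.
split=> [|x]; first exact: ric_psd.
by rewrite -fixP /=; apply: ric_mono => //; apply: posdef_psd.
Qed.

Lemma riccati_iter_gap k : posdef (gap (riccati_iter k)).
Proof. by have [[s _] le_P] := riccati_iter_bounds k; apply: gap_posdef_le pM. Qed.

Lemma riccati_iter_mono k x :
  qnorm (riccati_iter k) x <= qnorm (riccati_iter k.+1) x.
Proof.
elim: k x => [|k IHk] x.
  have [[_ g] _] := riccati_iter_bounds 1; apply: le_trans (g x).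
  by rewrite qnormE mul0mx dotC dot0l.
have [psd1 _] := riccati_iter_bounds k; have [psd2 _] := riccati_iter_bounds k.+1.
have g1 := riccati_iter_gap k; have g2 := riccati_iter_gap k.+1.
exact: (ric_mono A B Q hR _ psd1 psd2 g1 g2 IHk).
Qed.

(** The remaining terms of the cost are nonnegative, so a relative error on the
    worst-case term is a relative error on the whole cost, uniformly in the
    control. *)
Lemma rcost_continuous (P0 : 'M[R]_n) : posdef P0 -> posdef (gap P0) ->
  exists2 C : R, 0 <= C & forall P' (e : R), 0 <= e -> P'^T = P' ->
    posdef (gap P') ->
    (forall x, qnorm P0 x - e * dot x x <= qnorm P' x) ->
    forall x u, (1 - C * e) * rcost P0 x u <= rcost P' x u.
Proof.
move=> p0 m0; have [C C0 hC] := supmx_continuous gamma0 p0 m0.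
exists C => // P' e e0 sP' pM' le_P' x u; rewrite /rcost mulrDr lerD ?hC //.
rewrite ler_piMl //; first by rewrite addr_ge0 // posdef_ge0.
by rewrite lerBlDr lerDl mulr_ge0.
Qed.

(** The iterates increase to a solution of the Riccati equation below [P]: the
    limit dominates its image by monotonicity, and the converse inequality
    follows from the semicontinuity of the cost. *)
Lemma riccati_iter_cvg : exists P', [/\ posdef P', posdef (gap P'),
    riccati A B Q Rm gamma P', forall x, qnorm P' x <= qnorm P x &
    forall e : R, 0 < e -> exists N, forall k, (N <= k)%N -> forall x,
      qnorm P' x - e * dot x x <= qnorm (riccati_iter k) x].
Proof.
have symk k : (riccati_iter k)^T = riccati_iter k.
  by have [[]] := riccati_iter_bounds k.
have bdk k := (riccati_iter_bounds k).2.
have [P' [sP' cvP']] := monotone_qnorm_cvg symk riccati_iter_mono bdk.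
have cv e : 0 < e -> exists N, forall k, (N <= k)%N -> forall x,
    (qnorm P' x - e * dot x x <= qnorm (riccati_iter k) x) *
    (qnorm (riccati_iter k) x <= qnorm P' x + e * dot x x).
  move=> /cvP' [N hN]; exists N => k Nk x; have := hN k Nk x.
  by rewrite ler_norml => /andP[h1 h2]; split; lra.
have mono k l x : (k <= l)%N ->
    qnorm (riccati_iter k) x <= qnorm (riccati_iter l) x.
  move=> /subnK <-; elim: (l - k)%N => // d IHd.
  by rewrite addSn; apply: le_trans IHd _; apply: riccati_iter_mono.
have below k x : qnorm (riccati_iter k) x <= qnorm P' x.
  apply: (@le_forall_eps _ _ (dot x x)) => e e0 _; have [N hN] := cv e e0.
  apply: le_trans (mono k (maxn k N) x (leq_maxl _ _)) _.
  by rewrite mulrC; apply: (hN _ (leq_maxr _ _) x).2.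
have above x : qnorm P' x <= qnorm P x.
  apply: (@le_forall_eps _ _ (dot x x)) => e e0 _; have [N hN] := cv e e0.
  by have := (hN N (leqnn _) x).1; have := bdk N x; lra.
have p0 : possemidef (0 : 'M[R]_n) by have [] := riccati_iter_bounds 0.
have pP' : posdef P'.
  split=> // x x0; apply: lt_le_trans (below 1%N x).
  have le_Q : qnorm Q x <= qnorm (ric 0) x.
    by apply: ric_ge_Q => //; apply: (riccati_iter_gap 0).
  by apply: lt_le_trans le_Q; apply: hQ.2.
have psdP' := posdef_psd pP'.
have pM' : posdef (gap P') by apply: gap_posdef_le pM.
have [C C0 hC] := rcost_continuous pP' pM'.
exists P'; split=> // [x|e e0]; last first.
  by have [N hN] := cv e e0; exists N => k Nk x; case: (hN k Nk x).
rewrite ric_inf //; congr (_%:E); apply/eqP; rewrite eq_le; apply/andP; split.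
  apply: (@le_forall_eps _ _ (dot x x)) => e e0 _; have [N hN] := cv e e0.
  have [h _] := hN N.+1 (leqnSn N) x; have [psdN _] := riccati_iter_bounds N.
  rewrite -lerBlDr mulrC; apply: le_trans h _.
  exact: (ric_mono A B Q hR x psdN psdP' (riccati_iter_gap N) pM' (below N)).
apply: (@le_forall_eps _ _ (C * qnorm (ric P') x)) => e e0 _.
have [N hN] := cv e e0; have [psdN _] := riccati_iter_bounds N.
have pMN := riccati_iter_gap N.
apply: (@le_trans _ _ (qnorm (ric (riccati_iter N)) x
    + C * qnorm (ric P') x * e)); last by rewrite lerD2r; exact: (below N.+1 x).
set u := - (gain A B Rm gamma (riccati_iter N) *m x).
have h1 := hC _ e (ltW e0) (symk N) pMN (fun x => (hN N (leqnn N) x).1) x u.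
rewrite [X in _ <= X](ric_attained _ _ _ hR psdN pMN) in h1.
have h2 := ric_le A B Q hR psdP' pM' x u.
have [_ /(_ x) g] := ric_psd A B hQ hR psdN pMN.
have [_ /(_ x) g'] := ric_psd A B hQ hR psdP' pM'.
rewrite mulrAC; exact: (absorb_relative_error h1 h2 g g').
Qed.

End Bounded.
End RiccatiLimit.

(** * Reduction of the information state to two scalars *)

Section InformationState.
Local Set Implicit Arguments.
Local Unset Strict Implicit.
Variables (R : realType) (n m : nat) (A : 'M[R]_n) (B : 'M[R]_(n, m)).
Variables (Q : 'M[R]_n) (Rm : 'M[R]_m) (gamma : R).
Implicit Types (P : 'M[R]_n) (x v : 'cV[R]_n) (u : 'cV[R]_m).
Implicit Types (Z : 'M[R]_(n + n)) (V : 'cV[R]_n -> 'M[R]_(n + n) -> \bar R).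

(** The statistic in which the two signs differ: it is negative when the sign
    [1] explains the data with the smaller disturbance. *)
Definition corr Z : R := mxdot A (Ymx gamma Z).

(** The part of the accumulated disturbance energy common to both signs. *)
Definition energy Z : R := mxnorm2 Z (block_mx 1%:M 0 0 A)^T.

Definition update x u v Z : 'M[R]_(n + n) :=
  Z + col_mx (B *m u - v) x *m (col_mx (B *m u - v) x)^T.

Lemma corrE (Zul Zur Zdl Zdr : 'M[R]_n) :
  corr (block_mx Zul Zur Zdl Zdr) = gamma ^+ 2 * \tr (A^T *m Zur).
Proof.
rewrite /corr /mxdot /Ymx tr_row_mx trmx0 trmx1 mul_row_block !mul1mx !mul0mx.
by rewrite !addr0 mul_row_col mulmx0 mulmx1 add0r -scalemxAr mxtraceZ.
Qed.

Lemma energyE (Zul Zur Zdl Zdr : 'M[R]_n) :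
  energy (block_mx Zul Zur Zdl Zdr) = \tr Zul + \tr (A *m Zdr *m A^T).
Proof.
rewrite /energy /mxnorm2 trmxK tr_block_mx !trmx0 trmx1 !mulmx_block.
by rewrite !(mul1mx, mul0mx, mulmx0, mulmx1, addr0, add0r) mxtrace_block.
Qed.

Lemma sign_normE Z (i : R) : Z^T = Z -> i = 1 \/ i = -1 ->
  gamma ^+ 2 * mxnorm2 Z (row_mx 1%:M (i *: A))^T =
  gamma ^+ 2 * energy Z + 2 * i * corr Z.
Proof.
move=> + hi; have i2 : i * i = 1 by case: hi => ->; rewrite ?mulrNN mulr1.
rewrite -[Z]submxK; set Zul := ulsubmx Z; set Zur := ursubmx Z.
set Zdl := dlsubmx Z; set Zdr := drsubmx Z; move=> sZ.
have <- : Zur^T = Zdl by move: sZ; rewrite tr_block_mx => /eq_block_mx[].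
rewrite energyE corrE /mxnorm2 trmxK tr_row_mx trmx1 mul_row_block mul_row_col.
rewrite !mul1mx mulmx1 linearZ /= mulmxDl -!scalemxAl -!scalemxAr.
rewrite !mxtraceD !mxtraceZ -(mxtrace_tr (A *m Zur^T)) trmx_mul trmxK.
by rewrite (mxtrace_mulC Zur) mulrA i2 mul1r; ring.
Qed.

Lemma min_signE Z : Z^T = Z ->
  gamma ^+ 2 * min_sign A Z = gamma ^+ 2 * energy Z - 2 * `|corr Z|.
Proof.
move=> sZ; rewrite /min_sign minr_pMr ?sqr_ge0 //.
rewrite !sign_normE //; try by [left|right].
by case: (ger0P (corr Z)) => h; case: leP => h'; lra.
Qed.

Lemma update_block (a x : 'cV[R]_n) :
  col_mx a x *m (col_mx a x)^T =
  block_mx (a *m a^T) (a *m x^T) (x *m a^T) (x *m x^T).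
Proof. by rewrite tr_col_mx mul_col_row. Qed.

Lemma mxtrace_outer p (a b : 'cV[R]_p) : \tr (a *m b^T) = dot b a.
Proof. by rewrite mxtrace_mulC /dot /mxtrace big_ord1. Qed.

Lemma corr_outer a x :
  corr (col_mx a x *m (col_mx a x)^T) = gamma ^+ 2 * dot a (A *m x).
Proof. by rewrite update_block corrE mulmxA mxtrace_outer dotC dot_mull trmxK. Qed.

Lemma corr_update x u v Z :
  corr (update x u v Z) = corr Z + gamma ^+ 2 * dot (B *m u - v) (A *m x).
Proof.
rewrite -corr_outer /corr /mxdot /Ymx /update !(mulmxDl, mulmxDr) scalerDr.
by rewrite mulmxDr mxtraceD.
Qed.

Lemma energy_update x u v Z :
  energy (update x u v Z) =
  energy Z + dot (B *m u - v) (B *m u - v) + dot (A *m x) (A *m x).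
Proof.
rewrite -addrA -[X in _ = _ + X](_ : energy (col_mx (B *m u - v) x *m
    (col_mx (B *m u - v) x)^T) = _).
  by rewrite /energy /mxnorm2 /update !(mulmxDl, mulmxDr) mxtraceD.
by rewrite update_block energyE mulmxA -(mulmxA _ x^T) -trmx_mul !mxtrace_outer.
Qed.

Lemma psd_outer (z : 'cV[R]_(n + n)) : possemidef (z *m z^T).
Proof.
split=> [|x]; first by rewrite trmx_mul trmxK.
have zx : z^T *m x = (dot z x)%:M by rewrite [LHS]mx11_scalar.
by rewrite qnormE -mulmxA zx mul_mx_scalar dotZr dotC -expr2 sqr_ge0.
Qed.

Lemma psd_update x u v Z : possemidef Z -> possemidef (update x u v Z).
Proof.
move=> [sZ gZ]; have [so go] := psd_outer (col_mx (B *m u - v) x).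
split=> [|w]; first by rewrite /update linearD /= sZ so.
by rewrite qnormDm addr_ge0.
Qed.

Lemma corr_onto (x : 'cV[R]_n) (y : R) : 0 < gamma -> A \in unitmx ->
  (x = 0 -> y = 0) -> exists2 Z, possemidef Z & corr Z = y.
Proof.
move=> g0 uA hx; pose t := y / (gamma ^+ 2 * dot x x).
have psd := psd_outer (col_mx (t *: x) (invmx A *m x)); eexists; first exact: psd.
rewrite corr_outer mulKVmx // dotZl mulrCA /t.
have [x0|x0] := eqVneq x 0; first by rewrite (hx x0) mul0r mul0r.
have d0 : dot x x != 0.
  apply: contra x0 => /eqP d0; apply/eqP/(posdef_eq0 (posdef1 R n)).
  by rewrite qnorm_scalar d0 mulr0.
by rewrite divfK // mulf_neq0 // expf_neq0 // gt_eqF.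
Qed.

(** * Bellman operator *)

Lemma bellman_le V x Z u r :
  (forall v, ((qnorm Q x + qnorm Rm u)%:E + V v (update x u v Z) <= r)%E) ->
  (bellman B Q Rm V x Z <= r)%E.
Proof.
move=> h; apply: ge_ereal_inf; eexists; first by exists u.
by apply: ge_ereal_sup => _ [v _ <-]; apply: h.
Qed.

Lemma bellman_ge V x Z r :
  (forall u, exists v,
    (r <= (qnorm Q x + qnorm Rm u)%:E + V v (update x u v Z))%E) ->
  (r <= bellman B Q Rm V x Z)%E.
Proof.
move=> h; apply: le_ereal_inf_tmp => _ [u _ <-]; have [v hv] := h u.
by apply: le_trans hv _; apply: ereal_sup_ubound; exists v.
Qed.

Lemma bellman_mono V V' x Z :
  (forall x Z, possemidef Z -> (V x Z <= V' x Z)%E) -> possemidef Z ->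
  (bellman B Q Rm V x Z <= bellman B Q Rm V' x Z)%E.
Proof.
move=> leV pZ; apply: le_ereal_inf_tmp => _ [u _ <-].
apply: ge_ereal_inf; eexists; first by exists u.
apply: ge_ereal_sup => _ [v _ <-].
apply: le_trans (_ : (_ + V' v (update x u v Z) <= _)%E).
  by apply: leeD2l; apply: leV; apply: psd_update.
by apply: ereal_sup_ubound; exists v.
Qed.

Lemma bellman_approx V x Z (r e : R) : (bellman B Q Rm V x Z <= r%:E)%E ->
  0 < e -> exists u, forall v,
    ((qnorm Q x + qnorm Rm u)%:E + V v (update x u v Z) <= (r + e)%:E)%E.
Proof.
move=> le_r e0; have /ereal_inf_lt[_ [u _ <-] ltr] :
    (bellman B Q Rm V x Z < (r + e)%:E)%E.
  by apply: le_lt_trans le_r _; rewrite lte_fin ltrDl.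
exists u => v; apply: le_trans (ltW ltr); apply: ereal_sup_ubound.
by exists v.
Qed.

Definition sign_value P x Z : R := qnorm P x - gamma ^+ 2 * min_sign A Z.

Lemma sign_valueE P x Z : Z^T = Z ->
  sign_value P x Z = qnorm P x + 2 * `|corr Z| - gamma ^+ 2 * energy Z.
Proof. by move=> sZ; rewrite /sign_value min_signE //; ring. Qed.

Lemma sign_value_update P x u v Z (j : R) : j = 1 \/ j = -1 ->
  qnorm P v + 2 * j * corr Z - gamma ^+ 2 * energy Z
    - gamma ^+ 2 * enorm2 (B *m u - j *: (A *m x) - v) =
  qnorm P v + 2 * j * corr (update x u v Z) - gamma ^+ 2 * energy (update x u v Z).
Proof.
move=> hj; rewrite corr_update energy_update (addrAC (B *m u)) enorm2E.
move: (B *m u - v) => a; rewrite !(dotDl, dotDr, dotNl, dotNr, dotZl, dotZr) (dotC _ a).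
by case: hj => ->; ring.
Qed.

Lemma rcost_sign P x u (j : R) : j = 1 \/ j = -1 ->
  rcost A B Q Rm gamma P x (- (j *: u)) =
  qnorm Q x + qnorm Rm u + qnorm (supmx gamma P) (B *m u - j *: (A *m x)).
Proof.
rewrite /rcost mulmxN qnormN -scalemxAr; case=> ->; first last.
  by rewrite !scaleN1r !opprK qnormN addrC addrC [A *m x + _]addrC.
by rewrite !scale1r -[A *m x - _]opprB qnormN.
Qed.

(** Against a value function above [sign_value P] the adversary may bet on a
    sign [j]; the bet turns the game into the one with known sign. *)
Lemma sign_bet P V x Z u (j : R) : P^T = P -> posdef (gap gamma P) ->
  (forall x Z, possemidef Z -> ((sign_value P x Z)%:E <= V x Z)%E) ->
  possemidef Z -> j = 1 \/ j = -1 ->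
  exists v, ((rcost A B Q Rm gamma P x (- (j *: u)) + 2 * j * corr Z
              - gamma ^+ 2 * energy Z)%:E
             <= (qnorm Q x + qnorm Rm u)%:E + V v (update x u v Z))%E.
Proof.
move=> sP pM leV pZ hj; set z := B *m u - j *: (A *m x).
pose v := worst_state gamma P z; exists v; have pZ' := psd_update x u v pZ.
apply: (@le_trans _ _ ((qnorm Q x + qnorm Rm u)%:E
    + (sign_value P v (update x u v Z))%:E)%E); last by apply: leeD2l; apply: leV.
rewrite -EFinD lee_fin sign_valueE; last by case: pZ'.
have := sign_value_update P x u v Z hj; rewrite -/z rcost_sign // -/z.
have := supmx_attained z sP pM; rewrite -/v.
have : j * corr (update x u v Z) <= `|corr (update x u v Z)|.
  by case: hj => ->; rewrite ?mul1r ?mulN1r; [exact: ler_norm|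
    rewrite -normrN; exact: ler_norm].
by lra.
Qed.

Lemma sign_value_stage P x Z u (r : R) : P^T = P -> posdef (gap gamma P) ->
  possemidef Z ->
  (forall j, j = 1 \/ j = -1 -> rcost A B Q Rm gamma P x (- (j *: u))
     + 2 * j * corr Z - gamma ^+ 2 * energy Z <= r) ->
  forall v, qnorm Q x + qnorm Rm u + sign_value P v (update x u v Z) <= r.
Proof.
move=> sP pM pZ h v; have [sZ' _] := psd_update x u v pZ.
have [j hj ej] : exists2 j : R, j = 1 \/ j = -1 &
    `|corr (update x u v Z)| = j * corr (update x u v Z).
  case: (ger0P (corr (update x u v Z))) => _.
    by exists 1; [left|rewrite mul1r].
  by exists (-1); [right|rewrite mulN1r].
rewrite sign_valueE // ej; have := h j hj; rewrite rcost_sign //.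
have := supmx_ge (B *m u - j *: (A *m x)) v sP pM.
by have := sign_value_update P x u v Z hj; lra.
Qed.

End InformationState.

(** * The saturated value function *)

Section SaturatedValue.
Local Set Implicit Arguments.
Local Unset Strict Implicit.
Variables (R : realType) (n m : nat) (A : 'M[R]_n) (B : 'M[R]_(n, m)).
Variables (Q : 'M[R]_n) (Rm : 'M[R]_m) (gamma : R).
Variables (P T : 'M[R]_n) (K : 'M[R]_(m, n)).
Hypotheses (gamma0 : 0 < gamma) (hQ : posdef Q) (hR : posdef Rm).
Hypotheses (pP : posdef P) (pM : posdef (gap gamma P)).
Hypothesis fixP : forall x, qnorm (ric A B Q Rm gamma P) x = qnorm P x.
Hypothesis KE : K = gain A B Rm gamma P.
Hypothesis TE : T = Q + A^T *m supmx gamma P *m A.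
Hypothesis uD : T - P \in unitmx.
Hypothesis uA : A \in unitmx.

Local Notation M := (gap gamma P).
Local Notation S := (supmx gamma P).
Local Notation G := (control_weight B Rm gamma P).
Local Notation D := (T - P).
Local Notation corr := (corr A gamma).
Local Notation energy := (energy A).
Local Notation update := (update B).
Local Notation sign_value := (sign_value A gamma P).
Implicit Types (x v : 'cV[R]_n) (u : 'cV[R]_m) (Z : 'M[R]_(n + n)) (y : R).

Let psdP : possemidef P := posdef_psd pP.
Let sP : P^T = P := pP.1.
Let sM : M^T = M := pM.1.
Let uM : M \in unitmx := posdef_unit pM.
Let psdS : possemidef S := supmx_psd psdP pM.
Let pG : posdef G := control_weight_posdef B hR psdP pM.

Lemma GK_E : G *m K = B^T *m S *m A.
Proof. by rewrite KE; apply: gain_weight. Qed.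

Lemma qnormT x : qnorm T x = qnorm Q x + qnorm S (A *m x).
Proof. by rewrite TE qnormDm qnorm_congr. Qed.

Lemma qnormG u : qnorm G u = qnorm Rm u + qnorm S (B *m u).
Proof. by rewrite /control_weight qnormDm qnorm_congr. Qed.

Lemma rcost_fixed x u : rcost A B Q Rm gamma P x u = qnorm P x + qnorm G (u + K *m x).
Proof. by rewrite rcostE // fixP -KE. Qed.

Lemma qnormD_gain x : qnorm D x = qnorm G (K *m x).
Proof.
have := rcost_fixed x 0; rewrite add0r /rcost mulmx0 addr0 qnorm0 addr0 -qnormT.
by rewrite qnormBm => ->; rewrite addrAC subrr add0r.
Qed.

Lemma D_sym : D^T = D.
Proof.
by rewrite linearB /= sP TE linearD /= !trmx_mul trmxK psdS.1 hQ.1 !mulmxA.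
Qed.

Lemma posdef_D : posdef D.
Proof.
split=> [|x x0]; first exact: D_sym.
rewrite qnormD_gain lt_def posdef_ge0 // andbT; apply: contra x0 => /eqP Gx.
have Kx : K *m x = 0 by apply: (posdef_eq0 pG); rewrite Gx.
have Dx w : dot w (D *m x) = 0.
  have := qnormD w x D_sym; rewrite !qnormD_gain mulmxDr Kx qnorm0 !addr0.
  by move=> h; lra.
have : D *m x = 0 by apply: (posdef_eq0 (posdef1 R n)); rewrite qnorm_scalar Dx mulr0.
by rewrite -[x in x == 0](mulKmx uD) => ->; rewrite mulmx0.
Qed.

Let pD := posdef_D.

Definition saturated x y : R :=
  if qnorm D x <= `|y| then qnorm P x + 2 * `|y|
  else qnorm T x + y ^+ 2 * (qnorm D x)^-1.

Definition saturated_value x Z : R :=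
  saturated x (corr Z) - gamma ^+ 2 * energy Z.

(** [saturated x y] is [|x|_T^2] plus the Huber function, the maximum of
    [2 phi y - phi^2 |x|_D^2] over [phi] in [-1, 1]; the third clause is the
    optimality condition of that maximum.  At [x = 0] the maximizer [phi] is a sign of [y] although the
    quotient in the control law is zero, but then the control vanishes for
    every [phi]. *)
Lemma saturated_weight x y : exists phi : R,
  [/\ `|phi| <= 1,
      sat (y / qnorm D x) *: (K *m x) = phi *: (K *m x),
      `|y - phi * qnorm D x| = phi * (y - phi * qnorm D x) &
      saturated x y = qnorm T x + 2 * phi * y - phi ^+ 2 * qnorm D x].
Proof.
have TP : qnorm T x = qnorm P x + qnorm D x by rewrite qnormBm; ring.
have [->|x0] := eqVneq x 0.
  rewrite /saturated !qnorm0 normr_ge0 mulmx0; have [y0|y0] := leP 0 y.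
    exists 1; rewrite !scaler0 normr1 mulr0 subr0 (ger0_norm y0).
    by split=> //; lra.
  exists (-1); rewrite !scaler0 normrN normr1 mulr0 subr0 (ltr0_norm y0).
  by split=> //; lra.
have d0 : 0 < qnorm D x by apply: pD.2.
rewrite /saturated TP /sat ltr_pdivlMr // ltr_pdivrMr // mul1r mulN1r.
have [dy|yd] := leP (qnorm D x) `|y|.
  have [y0|y0] := leP 0 y.
    rewrite ger0_norm // in dy *; exists 1; rewrite normr1 !mul1r; split=> //.
    - case: ltP => // yd; have -> : y = qnorm D x by apply/le_anti; rewrite yd dy.
      by rewrite divff ?gt_eqF // ltNge ltW // (lt_trans _ d0) // oppr_lt0.
    - by rewrite ger0_norm // subr_ge0.
    - by ring.
  rewrite ltr0_norm // in dy *; exists (-1); rewrite normrN normr1; split=> //.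
  - have -> : (qnorm D x < y) = false by apply/negbTE; rewrite -leNgt; lra.
    case: ltP => // yd; have -> : y = - qnorm D x by lra.
    by rewrite mulNr divff ?gt_eqF.
  - by rewrite ler0_norm; lra.
  - by ring.
move: yd; rewrite ltr_norml => /andP[y1 y2].
exists (y / qnorm D x); rewrite divfK ?gt_eqF // subrr normr0 mulr0; split=> //.
- by rewrite ler_norml ler_pdivlMr // ler_pdivrMr // mulN1r mul1r !ltW.
- by rewrite !ltNge !ltW.
- by field; rewrite gt_eqF.
Qed.

Lemma saturated_ge x y (t : R) : `|t| <= 1 ->
  qnorm T x + 2 * t * y - t ^+ 2 * qnorm D x <= saturated x y.
Proof.
move=> t1; have [phi [_ _ opt ->]] := saturated_weight x y.
have d0 := posdef_ge0 x pD; set d := qnorm D x in d0 opt *.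
have : t * (y - phi * d) <= `|y - phi * d|.
  by apply: le_trans (ler_norm _) _; rewrite normrM ler_piMl.
have := mulr_ge0 d0 (sqr_ge0 (phi - t)); rewrite opt; nra.
Qed.

Lemma sign_value_le x Z : possemidef Z -> sign_value x Z <= saturated_value x Z.
Proof.
move=> [sZ _]; rewrite sign_valueE // /saturated_value lerD2r.
have e : qnorm T x = qnorm P x + qnorm D x by rewrite qnormBm; ring.
case: (ger0P (corr Z)) => y0.
  by have := @saturated_ge x (corr Z) 1; rewrite normr1 e => /(_ (lexx _)); lra.
by have := @saturated_ge x (corr Z) (-1); rewrite normrN normr1 e => /(_ (lexx _)); lra.
Qed.

(** * First Bellman step: minimizing the maximum over the two signs *)

Lemma sign_costE x u y (j : R) : j = 1 \/ j = -1 ->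
  rcost A B Q Rm gamma P x (- (j *: u)) + 2 * j * y =
  qnorm T x + qnorm G u + 2 * j * (y - dot (K *m x) (G *m u)).
Proof.
move=> hj; rewrite rcost_fixed addrC [- _ + _]addrC qnormD ?pG.1 //.
rewrite qnormN qnormZ -qnormD_gain qnormBm mulmxN -scalemxAr dotNr dotZr.
by case: hj => ->; ring.
Qed.

Lemma sign_bet_control x y phi (j : R) : j = 1 \/ j = -1 ->
  `|y - phi * qnorm D x| = phi * (y - phi * qnorm D x) ->
  saturated x y = qnorm T x + 2 * phi * y - phi ^+ 2 * qnorm D x ->
  rcost A B Q Rm gamma P x (- (j *: (phi *: (K *m x)))) + 2 * j * y
    <= saturated x y.
Proof.
move=> hj opt ->; rewrite sign_costE // qnormZ -scalemxAr dotZr -qnormE.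
rewrite -qnormD_gain.
have : j * (y - phi * qnorm D x) <= `|y - phi * qnorm D x|.
  by apply: le_trans (ler_norm _) _; rewrite normrM; case: hj => ->;
     rewrite ?normrN normr1 mul1r.
by rewrite opt; lra.
Qed.

Lemma sign_bet_growth x y phi u : `|phi| <= 1 ->
  saturated x y = qnorm T x + 2 * phi * y - phi ^+ 2 * qnorm D x ->
  exists2 j : R, j = 1 \/ j = -1 &
    saturated x y + qnorm G (u - phi *: (K *m x)) <=
    rcost A B Q Rm gamma P x (- (j *: u)) + 2 * j * y.
Proof.
move=> phi1 ->; set b := dot (K *m x) (G *m u).
have [j hj ej] : exists2 j : R, j = 1 \/ j = -1 & `|y - b| = j * (y - b).
  case: (ger0P (y - b)) => _; first by exists 1; [left|rewrite mul1r].
  by exists (-1); [right|rewrite mulN1r].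
exists j => //; rewrite sign_costE // -/b qnormD ?pG.1 // qnormN qnormZ.
rewrite -qnormD_gain mulmxN -scalemxAr dotNr dotZr (qnormC _ _ pG.1) -/b.
have : phi * (y - b) <= `|y - b|.
  by apply: le_trans (ler_norm _) _; rewrite normrM ler_piMl.
by rewrite ej; lra.
Qed.

Lemma bellman_sign_value x Z : possemidef Z ->
  bellman B Q Rm (fun x Z => (sign_value x Z)%:E) x Z = (saturated_value x Z)%:E.
Proof.
move=> pZ; have [phi [phi1 _ opt e]] := saturated_weight x (corr Z).
apply/eqP; rewrite eq_le; apply/andP; split.
  apply: (@bellman_le _ _ _ _ _ _ _ _ _ (phi *: (K *m x))) => v.
  rewrite -EFinD lee_fin; apply: sign_value_stage => // j hj.
  by rewrite lerD2r; apply: sign_bet_control.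
apply: bellman_ge => u; have [j hj le_j] := sign_bet_growth u phi1 e.
have [v hv] := @sign_bet _ _ _ A B Q Rm gamma P (fun x Z => (sign_value x Z)%:E)
  x Z u j sP pM (fun _ _ _ => lexx _) pZ hj.
exists v; apply: le_trans hv; rewrite lee_fin lerD2r; apply: le_trans le_j.
by rewrite lerDl posdef_ge0.
Qed.

(** * Second Bellman step: bets on fractional signs *)

Local Notation L := (B *m K *m invmx A).

(** The cost of a stage when the next value is replaced by the affine minorant
    of slope [2 t] from [saturated_ge]: a bet on a sign of mean [t]. *)
Definition stage_mix x u v y t : R :=
  qnorm Q x + qnorm Rm u - gamma ^+ 2 * (dot (B *m u - v) (B *m u - v))
    - gamma ^+ 2 * dot (A *m x) (A *m x)
    + (qnorm T v + 2 * t * (y + gamma ^+ 2 * dot (B *m u - v) (A *m x))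
       - t ^+ 2 * qnorm D v).

(** The first line is what a mix of the two signs with mean [t] would give; the
    rest is the deviation from it, with [1 - t^2] the variance of the mix. *)
Lemma stage_mixE x v y phi t :
  stage_mix x (phi *: (K *m x)) v y t =
  qnorm T x + phi ^+ 2 * qnorm D x + 2 * t * (y - phi * qnorm D x)
    + ((1 - t ^+ 2) * qnorm D v
       - qnorm M (v - worst_state gamma P
           (phi *: (L *m (A *m x)) - t *: (A *m x)))
       - (1 - t ^+ 2) * (gamma ^+ 4 * qnorm (invmx M) (A *m x))).
Proof.
rewrite /stage_mix; set u := phi *: (K *m x).
have -> : phi *: (L *m (A *m x)) = B *m u.
  by rewrite -!mulmxA (mulKmx uA) /u -!scalemxAr.
have du : dot (B *m u) (S *m (A *m x)) = phi * qnorm D x.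
  rewrite /u -scalemxAr dotZl !dot_mull qnormD_gain qnormE (mulmxA G) GK_E.
  by rewrite dot_mull !mulmxA.
have e4 : qnorm Rm u + qnorm S (B *m u) = phi ^+ 2 * qnorm D x.
  by rewrite -qnormG /u qnormZ -qnormD_gain.
clearbody u; set z := B *m u - t *: (A *m x).
have e1 := square_completion z v sP uM.
have e2 : enorm2 (z - v) = dot (B *m u - v) (B *m u - v)
    - 2 * t * dot (B *m u - v) (A *m x) + t ^+ 2 * dot (A *m x) (A *m x).
  rewrite /z enorm2E (addrAC (B *m u)); move: (B *m u - v) => a.
  by rewrite !(dotDl, dotDr, dotNl, dotNr, dotZl, dotZr) (dotC (A *m x)); ring.
have e3 : qnorm S z = qnorm S (B *m u) - 2 * t * (phi * qnorm D x)
    + t ^+ 2 * qnorm S (A *m x).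
  rewrite /z qnormD ?psdS.1 // qnormN qnormZ mulmxN -scalemxAr dotNr dotZr du.
  by ring.
have e5 : qnorm S (A *m x) =
    gamma ^+ 4 * qnorm (invmx M) (A *m x) - gamma ^+ 2 * dot (A *m x) (A *m x).
  by rewrite /supmx (qnormBm (_ *: _)) qnormZm qnorm_scalar.
have e6 : qnorm T v = qnorm P v + qnorm D v by rewrite qnormBm; ring.
rewrite e2 e3 e5 in e1; rewrite e6 qnormT e5 -e4 in e1 *; nra.
Qed.

(** The deviation in [stage_mixE] is nonpositive: with [z = A x] and the control
    [phi K x], a bet on a sign of mean [t] gains nothing over a mix of the two
    sure bets. *)
Definition mix_bound (phi t : R) : Prop := forall v z : 'cV[R]_n,
  (1 - t ^+ 2) * qnorm D v <=
  qnorm M (v - worst_state gamma P (phi *: (L *m z) - t *: z))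
    + (1 - t ^+ 2) * (gamma ^+ 4 * qnorm (invmx M) z).

Definition matrix_condition : Prop := forall s : R, s = 1 \/ s = -1 ->
  let L' := 1%:M + s *: L in
  possemidef (M *m invmx D *m M - L' *m M *m L'^T).

Lemma matrix_conditionP : matrix_condition <->
  forall s : R, s = 1 \/ s = -1 -> forall p : 'cV[R]_n,
    qnorm M (p + s *: (L^T *m p)) <= qnorm (M *m invmx D *m M) p.
Proof.
have E (s : R) p : qnorm ((1%:M + s *: L) *m M *m (1%:M + s *: L)^T) p =
    qnorm M (p + s *: (L^T *m p)).
  rewrite -[X in qnorm (X *m _ *m _)]trmxK qnorm_congr linearD /= linearZ /=.
  by rewrite trmx1 mulmxDl mul1mx -scalemxAl.
split=> h s hs.
  move=> p; have [_ /(_ p)] := h s hs.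
  by rewrite qnormBm E subr_ge0.
split=> [|p]; last by rewrite qnormBm E subr_ge0; apply: h.
by rewrite linearB /= !trmx_mul !trmxK trmx_inv D_sym sM !mulmxA.
Qed.

(** For [p = M^-1 D v] the weight [M D^-1 M] gives [|v|_D^2] again.  The two
    matrix inequalities are the extreme cases [phi, t = +-1] of a bound on it by
    [(1 - t^2) |p|_M^2 + |(phi L - t I)^T p|_M^2], and Young's inequality for
    the two parts of the pairing of [p] with [M v] gives the primal form. *)
Lemma matrix_condition_mix_bound phi t : matrix_condition ->
  `|phi| <= 1 -> `|t| <= 1 -> mix_bound phi t.
Proof.
move=> /matrix_conditionP hL phi1 t1 v z.
pose s := 1 - t ^+ 2; pose p := invmx M *m (D *m v).
pose w := phi *: (L *m z) - t *: z; pose e := v - worst_state gamma P w.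
rewrite -/s -/w -/e.
have t2 : t ^+ 2 <= 1 by rewrite -real_normK ?num_real // expr_le1.
have phi2 : phi ^+ 2 <= 1 by rewrite -real_normK ?num_real // expr_le1.
have s0 : 0 <= s by rewrite subr_ge0.
have Mp : M *m p = D *m v by rewrite mulKVmx.
have e1 : qnorm (M *m invmx D *m M) p = qnorm D v.
  rewrite -[X in X *m _ *m _]sM qnorm_congr Mp qnormE mulKmx // dotC.
  by rewrite qnormE.
have e2 : qnorm D v = dot p (M *m e) + gamma ^+ 2 * dot (phi *: (L^T *m p) - t *: p) z.
  have -> : M *m e = M *m v - gamma ^+ 2 *: w.
    by rewrite /e /worst_state mulmxBr -scalemxAr mulKVmx.
  rewrite dotDr dotNr dotZr (qnormC _ _ sM) Mp -qnormE.
  rewrite (_ : dot (_ - _) z = dot p w); first by ring.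
  by rewrite /w !(dotDl, dotDr, dotNl, dotNr, dotZl, dotZr) dot_mull trmxK.
have e3 : 2 * s * dot p (M *m e) <= s ^+ 2 * qnorm M p + qnorm M e.
  have := posdef_ge0 (e - s *: p) pM.
  rewrite qnormD // qnormN qnormZ mulmxN -scalemxAr dotNr dotZr.
  by rewrite (qnormC _ _ sM); lra.
set q := phi *: (L^T *m p) - t *: p in e2.
have e4 : 2 * (gamma ^+ 2 * dot q z) <= qnorm M q + gamma ^+ 4 * qnorm (invmx M) z.
  have := posdef_ge0 (q - gamma ^+ 2 *: (invmx M *m z)) pM.
  rewrite qnormD // qnormN qnormZ qnorm_inv // mulmxN -scalemxAr mulKVmx //.
  by rewrite dotNr dotZr -exprM; lra.
have e5 : s * qnorm M p + qnorm M q <= qnorm D v.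
  have := hL 1 (or_introl erefl) p; have := hL (-1) (or_intror erefl) p.
  rewrite e1 /q !qnormD // qnormN !qnormZ mulmxN -!scalemxAr !(dotNr, dotZr, dotZl).
  rewrite (qnormC (L^T *m p) p sM); set a := qnorm M p.
  set b := qnorm M (L^T *m p); set c := dot p _; rewrite /s => h1 h2.
  have b0 : 0 <= b by apply: posdef_ge0.
  have c1 : - (phi * t * c) <= `|c|.
    apply: le_trans (ler_norm _) _.
    by rewrite normrN !normrM ler_piMl // mulr_ile1.
  have c2 : a + b + 2 * `|c| <= qnorm D v by case: (ger0P c) => _; lra.
  have := ler_wpM2r b0 phi2; lra.
by have := ler_wpM2l s0 e4; have := ler_wpM2l s0 e5; nra.
Qed.

(** At the next state that annihilates the square, the inequality can be divided
    by [1 - t^2]; then [t] tends to 1, and duality gives the stated form. *)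
Lemma mix_bound_matrix_condition :
  (forall phi t : R, phi = 1 \/ phi = -1 -> `|t| <= 1 -> mix_bound phi t) ->
  matrix_condition.
Proof.
move=> h; apply/matrix_conditionP => s hs.
have hN : posdef (invmx M *m D *m invmx M).
  have si : (invmx M)^T = invmx M by rewrite trmx_inv sM.
  split=> [|x x0]; first by rewrite !trmx_mul si D_sym mulmxA.
  rewrite -[X in X *m _ *m _]si qnorm_congr; apply: pD.2.
  by apply: contra x0 => /eqP e; rewrite -(mulKVmx uM x) e mulmx0.
pose W := 1%:M + s *: L.
have contr x : qnorm (invmx M *m D *m invmx M) (W *m x) <= qnorm (invmx M) x.
  have si : (invmx M)^T = invmx M by rewrite trmx_inv sM.
  rewrite -[X in X *m _ *m _]si qnorm_congr.
  pose a := invmx M *m (W *m x); pose b := invmx M *m x; rewrite -/a.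
  apply: (@le_forall_eps _ _ _ (2 * dot a (D *m b))) => e e0 e1.
  pose t := 1 - e.
  have t1 : `|t| <= 1 by rewrite ler_norml /t; lra.
  have hs' : - s = 1 \/ - s = -1 by case: hs => ->; rewrite ?opprK; [right|left].
  pose w := (- s) *: (L *m x) - t *: x.
  have := h (- s) t hs' t1 (worst_state gamma P w) x; rewrite -/w subrr qnorm0 add0r.
  have s0 : 0 < 1 - t ^+ 2 by rewrite /t; nra.
  rewrite ler_pM2l // /worst_state qnormZ -exprM ler_pM2l ?exprn_gt0 //.
  have -> : invmx M *m w = - (a - e *: b).
    have -> : w = - (W *m x - e *: x).
      rewrite /w /t /W mulmxDl mul1mx -scalemxAl scaleNr scalerBl scale1r.
      by rewrite !opprB opprD [LHS]addrC [RHS]addrA.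
    by rewrite mulmxN mulmxBr -scalemxAr.
  rewrite qnormN qnormD ?D_sym // qnormN qnormZ mulmxN -scalemxAr dotNr dotZr.
  by have := mulr_ge0 (sqr_ge0 e) (posdef_ge0 b pD); lra.
move=> p; have := contraction_dual pM hN contr p.
have -> : invmx (invmx M *m D *m invmx M) = M *m invmx D *m M.
  have e : (invmx M *m D *m invmx M) *m (M *m invmx D *m M) = 1%:M.
    by rewrite !mulmxA mulmxKV // mulmxK // mulVmx.
  by have [uN _] := mulmx1_unit e; rewrite -[LHS]mulmx1 -e mulKmx.
by rewrite /W linearD /= linearZ /= trmx1 mulmxDl mul1mx -scalemxAl.
Qed.

Definition sat_control x Z : 'cV[R]_m := sat (corr Z / qnorm D x) *: (K *m x).

Lemma saturated_stage x v Z : matrix_condition -> possemidef Z ->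
  qnorm Q x + qnorm Rm (sat_control x Z)
    + saturated_value v (update x (sat_control x Z) v Z) <= saturated_value x Z.
Proof.
move=> hL pZ; rewrite /sat_control /saturated_value.
have [phi [phi1 -> opt ->]] := saturated_weight x (corr Z).
have [t [t1 _ _ ->]] := saturated_weight v
  (corr (update x (phi *: (K *m x)) v Z)).
rewrite corr_update energy_update.
have := stage_mixE x v (corr Z) phi t.
have := matrix_condition_mix_bound hL phi1 t1 v (A *m x).
have : t * (corr Z - phi * qnorm D x) <= `|corr Z - phi * qnorm D x|.
  by apply: le_trans (ler_norm _) _; rewrite normrM ler_piMl.
by rewrite opt /stage_mix; lra.
Qed.

Lemma bellman_saturated_value x Z : matrix_condition -> possemidef Z ->
  bellman B Q Rm (fun x Z => (saturated_value x Z)%:E) x Z =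
  (saturated_value x Z)%:E.
Proof.
move=> hL pZ; apply/eqP; rewrite eq_le; apply/andP; split.
  apply: (@bellman_le _ _ _ _ _ _ _ _ _ (sat_control x Z)) => v.
  by rewrite -EFinD lee_fin saturated_stage.
rewrite -bellman_sign_value //; apply: bellman_mono => // {x Z pZ} x Z pZ.
by rewrite lee_fin sign_value_le.
Qed.

(** An almost optimal control is close to [phi K x] because the first Bellman
    step grows quadratically around it; the stage cost for a fixed next state
    is continuous, so its bound passes to [phi K x] itself. *)
Lemma optimal_control_limit x Z phi : possemidef Z -> `|phi| <= 1 ->
  saturated x (corr Z) = qnorm T x + 2 * phi * corr Z - phi ^+ 2 * qnorm D x ->
  (bellman B Q Rm (fun x Z => (saturated_value x Z)%:E) x Z
    <= (saturated_value x Z)%:E)%E ->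
  forall v t, `|t| <= 1 ->
    stage_mix x (phi *: (K *m x)) v (corr Z) t <= saturated x (corr Z).
Proof.
move=> pZ phi1 sE le_b v t t1; set u := phi *: (K *m x).
pose J w := stage_mix x w v (corr Z) t; rewrite -/(J u).
have near_opt e : 0 < e -> exists w : 'cV[R]_m,
    qnorm G (w - u) <= e /\ J w <= saturated x (corr Z) + e.
  move=> e0; have [w hw] := bellman_approx le_b e0; exists w; split.
    have [j hj le_j] := sign_bet_growth w phi1 sE.
    have [v' hv'] := @sign_bet _ _ _ A B Q Rm gamma P
      (fun x Z => (sign_value x Z)%:E) x Z w j sP pM (fun _ _ _ => lexx _) pZ hj.
    have := hw v'; move: hv'; rewrite -!EFinD !lee_fin => hv' hwv'.
    have := sign_value_le v' (psd_update B x w v' pZ).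
    by move: le_j hwv'; rewrite -/u {2}/saturated_value; lra.
  have := hw v; rewrite -EFinD lee_fin /saturated_value corr_update energy_update.
  have := saturated_ge v (corr Z + gamma ^+ 2 * dot (B *m w - v) (A *m x)) t1.
  by rewrite /J /stage_mix; lra.
pose b := 2 *: (Rm *m u) - (2 * gamma ^+ 2) *: (B^T *m (B *m u - v))
          + (2 * t * gamma ^+ 2) *: (B^T *m (A *m x)).
have bE h : dot b h = 2 * dot h (Rm *m u)
    - 2 * gamma ^+ 2 * dot (B *m u - v) (B *m h)
    + 2 * t * gamma ^+ 2 * dot (B *m h) (A *m x).
  rewrite /b; move: (B *m u - v) => a; rewrite !(dotDl, dotNl, dotZl).
  by rewrite !(dot_mull B^T) trmxK (dotC _ h) (dotC (A *m x)).
have JD h : J (u + h) = J u + dot b h + qnorm Rm h - gamma ^+ 2 * dot (B *m h) (B *m h).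
  rewrite /J /stage_mix bE (_ : B *m (u + h) - v = (B *m u - v) + B *m h).
    rewrite qnormD ?hR.1 // (qnormC _ _ hR.1); move: (B *m u - v) => a.
    by rewrite !(dotDl, dotDr) (dotC (B *m h) a); ring.
  by rewrite mulmxDr addrAC.
clearbody b; have [C C0 hC] := posdef_dominates pG.
pose c := entrynorm (B^T *m 1%:M *m B).
have hB h : dot (B *m h) (B *m h) <= c * dot h h.
  apply: le_trans (qnorm_le_entrynorm _ h).
  by rewrite qnorm_congr qnorm_scalar mul1r.
have c0 : 0 <= c by apply: entrynorm_ge0.
apply: (@le_forall_eps _ _ _ (1 + dot b b + C + gamma ^+ 2 * c * C)) => e e0 e1.
have [w [hw1 hw2]] := near_opt (e ^+ 2) (exprn_gt0 _ e0).
have := JD (w - u); rewrite addrC subrK; move: (w - u) hw1 => h hw1 Jw.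
have hh : dot h h <= C * e ^+ 2.
  by apply: le_trans (hC h) _; apply: ler_wpM2l.
have e2 : e ^+ 2 <= e by rewrite expr2 ler_piMl // ltW.
have Ce : C * e ^+ 2 <= C * e by apply: ler_wpM2l.
(* [|dot b h|] is of order [e] because [|h|] is. *)
have bh : - dot b h <= dot b b * e + C * e.
  have := dot_ge0 (e *: b + h).
  rewrite !(dotDl, dotDr, dotZl, dotZr) (dotC h b) => pos.
  have Cee : C * e ^+ 2 = e * (C * e) by rewrite expr2; ring.
  rewrite -(ler_pM2l e0); have := dot_ge0 b; nra.
have gB : gamma ^+ 2 * dot (B *m h) (B *m h) <= gamma ^+ 2 * c * C * e.
  have -> : gamma ^+ 2 * c * C * e = gamma ^+ 2 * (c * (C * e)) by ring.
  apply: ler_wpM2l; first exact: sqr_ge0.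
  apply: le_trans (hB h) _; apply: ler_wpM2l => //; exact: le_trans hh _.
have := posdef_ge0 h hR; lra.
Qed.

(** The fixed point is tested at [y = |x|_D^2] and [y = - |x|_D^2], where the
    saturated control is [K x] or [- K x] and both signs have the same cost. *)
Lemma saturated_fixpoint_matrix_condition :
  (forall x Z, possemidef Z ->
    (bellman B Q Rm (fun x Z => (saturated_value x Z)%:E) x Z
      <= (saturated_value x Z)%:E)%E) ->
  matrix_condition.
Proof.
move=> le_b; apply: mix_bound_matrix_condition => phi t hphi t1 v z.
have phi1 : `|phi| <= 1 by case: hphi => ->; rewrite ?normrN normr1.
have phi2 : phi ^+ 2 = 1 by case: hphi => ->; rewrite ?sqrrN expr1n.
have [x Ax] : exists x, A *m x = z by exists (invmx A *m z); rewrite mulKVmx.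
have [Z pZ ZE] : exists2 Z, possemidef Z & corr Z = phi * qnorm D x.
  by apply: (@corr_onto _ _ A gamma x) => // ->; rewrite qnorm0 mulr0.
have sE : saturated x (corr Z) =
    qnorm T x + 2 * phi * corr Z - phi ^+ 2 * qnorm D x.
  rewrite /saturated ZE normrM (_ : `|phi| = 1); last first.
    by case: hphi => ->; rewrite ?normrN normr1.
  rewrite mul1r ler_norm ger0_norm ?posdef_ge0 // mulrA -(mulrA 2) -expr2 phi2.
  by rewrite qnormBm; ring.
have := optimal_control_limit pZ phi1 sE (le_b x Z pZ) v t1.
rewrite stage_mixE sE ZE Ax subrr mulr0 -(mulrA 2) mulrA.
have -> : 2 * phi * (phi * qnorm D x) = 2 * qnorm D x.
  by rewrite mulrA -(mulrA 2) -expr2 phi2 mulr1.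
by rewrite phi2; lra.
Qed.

End SaturatedValue.

(** * Plays of the game *)

Section Plays.
Local Set Implicit Arguments.
Local Unset Strict Implicit.
Variables (R : realType) (n m : nat) (A : 'M[R]_n) (B : 'M[R]_(n, m)).
Variables (Q : 'M[R]_n) (Rm : 'M[R]_m) (gamma : R).
Local Notation update := (update B).
Local Notation corr := (corr A gamma).
Local Notation energy := (energy A).

Section Law.
Variables (mu : control_law R n m) (x0 : 'cV[R]_n).
Implicit Types (i : R) (w : nat -> 'cV[R]_n).
Local Notation history := (history A B mu x0).
Local Notation state := (state A B mu x0).
Local Notation input := (input A B mu x0).

Lemma tnth_rcons_max (S : Type) k (s : k.-tuple S) a :
  tnth (rcons_tuple s a) ord_max = a.
Proof. by rewrite (tnth_nth a) /= nth_rcons size_tuple ltnn eqxx. Qed.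

Lemma state_succ i w t :
  state i w t.+1 = i *: (A *m state i w t) + B *m input i w t + w t.
Proof. by rewrite /state /= tnth_rcons_max. Qed.

Lemma nth_states i w t k : (k <= t)%N -> nth 0 (history i w t).1 k = state i w k.
Proof.
elim: t => [|t IHt]; first by rewrite leqn0 => /eqP->.
rewrite leq_eqVlt => /orP[/eqP->|kt]; first by rewrite /state (tnth_nth 0).
by rewrite /= nth_rcons size_tuple kt IHt.
Qed.

Lemma nth_inputs i w t k : (k < t)%N -> nth 0 (history i w t).2 k = input i w k.
Proof.
elim: t => // t IHt; rewrite ltnS leq_eqVlt => /orP[/eqP->|kt].
  by rewrite /= nth_rcons size_tuple ltnn eqxx.
by rewrite /= nth_rcons size_tuple kt IHt.
Qed.

Lemma history_ext i w w' t : (forall s, (s < t)%N -> w s = w' s) ->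
  history i w t = history i w' t.
Proof.
elim: t => //= t IHt h; rewrite IHt => [|s st]; last by apply: h; apply: ltnW.
by rewrite h.
Qed.

(** Absorbing the drift into the disturbance makes the play independent of the
    sign, so that the adversary may choose the sign at the end. *)
Lemma history_sign i w w' :
  (forall t, w' t = w t + i *: (A *m state 0 w' t)) ->
  forall t, history i w t = history 0 w' t.
Proof.
move=> h; elim=> //= t ->; congr (rcons_tuple _ _, _).
by rewrite h /state scale0r add0r [RHS]addrA [RHS]addrC [RHS]addrA.
Qed.

Fixpoint info i w t : 'M[R]_(n + n) :=
  if t is t'.+1 then
    update (state i w t') (input i w t') (state i w t'.+1) (info i w t')
  else 0.

Lemma psd_info i w t : possemidef (info i w t).
Proof.
elim: t => [|t IHt] /=; last exact: psd_update.
by split=> [|x]; rewrite ?trmx0 // qnormE mul0mx dotC dot0l.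
Qed.

Lemma corr0 : corr 0 = 0.
Proof. by rewrite /corr /mxdot /Ymx mulmx0 mul0mx scaler0 mulmx0 mxtrace0. Qed.

Lemma energy0 : energy 0 = 0.
Proof. by rewrite /energy /mxnorm2 mulmx0 mul0mx mxtrace0. Qed.

Lemma corr_info i w t : corr (info i w t) = gamma ^+ 2 *
  \sum_(0 <= s < t) dot (B *m input i w s - state i w s.+1) (A *m state i w s).
Proof.
elim: t => [|t IHt]; first by rewrite big_geq // mulr0 corr0.
by rewrite big_nat_recr //= mulrDr -IHt corr_update.
Qed.

(** The same states and controls also form a play with the sign [j], for another
    disturbance; both signs are therefore scored on one play. *)
Lemma disturbance_energy i w (j : R) t : j = 1 \/ j = -1 ->
  gamma ^+ 2 * \sum_(0 <= s < t)
    enorm2 (state i w s.+1 - B *m input i w s - j *: (A *m state i w s)) =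
  gamma ^+ 2 * energy (info i w t) + 2 * j * corr (info i w t).
Proof.
move=> hj; elim: t => [|t IHt].
  by rewrite big_geq // energy0 corr0 !mulr0 addr0.
rewrite big_nat_recr //= mulrDr IHt corr_update energy_update enorm2E.
rewrite -[state i w t.+1 - _]opprB; move: (B *m input i w t - state i w t.+1) => a.
move: (A *m state i w t) => b.
rewrite !(dotDl, dotDr, dotNl, dotNr, dotZl, dotZr) (dotC b a).
by case: hj => ->; ring.
Qed.

Definition control_cost i w t : R :=
  \sum_(0 <= s < t) (qnorm Q (state i w s) + qnorm Rm (input i w s)).

Lemma costE i w N : i = 1 \/ i = -1 ->
  cost A B Q Rm gamma mu x0 w i N = control_cost i w N.+1
    - (gamma ^+ 2 * energy (info i w N.+1) + 2 * i * corr (info i w N.+1)).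
Proof.
move=> hi; rewrite /cost big_split sumrN -mulr_sumr -(disturbance_energy _ _ _ hi).
congr (_ - _ * _); apply: eq_bigr => t _; rewrite state_succ.
by rewrite (addrAC _ (B *m _)) addrK addrAC subrr add0r.
Qed.

Local Notation V := (V_iter A B Q Rm gamma).

Lemma info_ext i w w' t : (forall s, (s < t)%N -> w s = w' s) ->
  info i w t = info i w' t.
Proof.
elim: t => //= t IHt h.
have ht s : (s < t)%N -> w s = w' s by move=> st; apply/h/ltnW.
by rewrite IHt // !state_succ /input /state (history_ext _ ht) h.
Qed.

Lemma control_cost_ext i w w' t : (forall s, (s < t)%N -> w s = w' s) ->
  control_cost i w t = control_cost i w' t.
Proof.
move=> h; apply: eq_big_nat => s /andP[_ st].
by rewrite /input /state (history_ext _ (_ : forall r, (r < s)%N -> w r = w' r)) // => r rs;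
  apply/h/(ltn_trans rs).
Qed.

(** With the sign [0] the disturbances prescribe the states directly; each state
    is a nearly maximizing answer to the control that the law has chosen. *)
Lemma adversary_states (c : R) j k : (c%:E < V (j + k) x0 0)%E ->
  exists w, (c%:E < (control_cost 0 w j)%:E + V k (state 0 w j) (info 0 w j))%E.
Proof.
elim: j k => [|j IHj] k hc.
  by exists (fun=> 0); rewrite /control_cost big_geq // add0e.
rewrite addSnnS in hc; have [w] := IHj _ hc.
set x := state 0 w j; set Z := info 0 w j; pose u := input 0 w j.
rewrite -lteBlDl // => /lt_le_trans lt_sup.
have /lt_sup : (V k.+1 x Z <= ereal_sup [set ((qnorm Q x + qnorm Rm u)%:E
    + V k v (update x u v Z))%E | v in [set: 'cV[R]_n]])%E.
  by apply: ereal_inf_lbound; exists u.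
move=> /ereal_sup_gt[_ [v _ <-]] ltv.
exists (fun t => if t == j then v - B *m u else w t).
set w' := fun t => _.
have ext s : (s < j)%N -> w' s = w s by rewrite /w'; case: ltngtP.
have ej : history 0 w' j = history 0 w j by apply: history_ext.
have sj : state 0 w' j = x by rewrite /state ej.
have uj : input 0 w' j = u by rewrite /input ej.
have sj1 : state 0 w' j.+1 = v.
  by rewrite state_succ sj uj scale0r add0r /w' eqxx addrC subrK.
rewrite /control_cost big_nat_recr //= -/(control_cost _ _ _).
rewrite (control_cost_ext 0 ext) (info_ext 0 ext) sj uj sj1 EFinD -addeA.
by rewrite -lteBlDl.
Qed.

(** The terminal value [V_0] is the maximum over the signs of minus the
    disturbance energy, so a sign chosen after the last stage attains it. *)
Lemma worst_cost_ge N :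
  (V N.+1 x0 0 <= worst_cost A B Q Rm gamma mu x0)%E.
Proof.
rewrite leNgt; apply/negP => ltV.
have ub w i : i = 1 \/ i = -1 ->
    ((cost A B Q Rm gamma mu x0 w i N)%:E <= worst_cost A B Q Rm gamma mu x0)%E.
  by move=> hi; apply: ereal_sup_ubound; exists w, i, N.
case e : (worst_cost A B Q Rm gamma mu x0) ltV ub => [r| |] ltV ub; first last.
- by have := ub (fun=> 0) 1 (or_introl erefl); rewrite leeNy_eq.
- by move: ltV; rewrite ltNge leey.
have := @adversary_states r N.+1 0; rewrite addn0 => /(_ ltV)[w' lt_r].
set Z := info 0 w' N.+1 in lt_r; have [sZ _] := psd_info 0 w' N.+1.
have [i hi ei] : exists2 i : R, i = 1 \/ i = -1 & - `|corr Z| = i * corr Z.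
  case: (ger0P (corr Z)) => _; first by exists (-1); [right|rewrite mulN1r].
  by exists 1; [left|rewrite opprK mul1r].
pose w t := w' t - i *: (A *m state 0 w' t).
have hw := @history_sign i w w' (fun t => esym (subrK _ _)).
have sE t : state i w t = state 0 w' t by rewrite /state hw.
have uE t : input i w t = input 0 w' t by rewrite /input hw.
have ZE t : info i w t = info 0 w' t by elim: t => //= t ->; rewrite !sE uE.
have := ub w i hi; rewrite costE // ZE -/Z lee_fin leNgt => /negP; apply.
rewrite (_ : control_cost i w N.+1 = control_cost 0 w' N.+1); last first.
  by apply: eq_bigr => t _; rewrite sE uE.
move: lt_r; rewrite /= -EFinD lte_fin min_signE // -mulrA -ei.
by lra.
Qed.

End Law.

Section SaturatedLaw.
Variables (K : 'M[R]_(m, n)) (P T : 'M[R]_n).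

Lemma sat_law_input x0 i w t :
  let mu := sat_law A B gamma K (T - P) in
  input A B mu x0 i w t =
  sat_control A gamma P T K (state A B mu x0 i w t) (info mu x0 i w t).
Proof.
move=> mu; rewrite /input {1}/mu /sat_law nth_states // /sat_control corr_info.
congr (sat (_ * _ / _) *: _); apply: eq_big_nat => s /andP[_ st].
by rewrite nth_inputs // !nth_states // ltnW.
Qed.

End SaturatedLaw.
End Plays.

(** * Value iteration and the minimizing law *)

Section Value.
Local Set Implicit Arguments.
Local Unset Strict Implicit.
Variables (R : realType) (n m : nat) (A : 'M[R]_n) (B : 'M[R]_(n, m)).
Variables (Q : 'M[R]_n) (Rm : 'M[R]_m) (gamma : R).
Variables (P T : 'M[R]_n) (K : 'M[R]_(m, n)).
Hypotheses (gamma0 : 0 < gamma) (hQ : posdef Q) (hR : posdef Rm).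
Hypotheses (pP : posdef P) (pM : posdef (gap gamma P)).
Hypothesis fixP : forall x, qnorm (ric A B Q Rm gamma P) x = qnorm P x.
Hypothesis KE : K = gain A B Rm gamma P.
Hypothesis TE : T = Q + A^T *m supmx gamma P *m A.
Hypothesis uD : T - P \in unitmx.
Hypothesis uA : A \in unitmx.

Local Notation corr := (corr A gamma).
Local Notation energy := (energy A).
Local Notation saturated_value := (saturated_value A gamma P T).
Local Notation matrix_condition := (matrix_condition A B gamma P T K).
Local Notation Vbar := (Vbar_iter A B Q Rm gamma P).
Local Notation V := (V_iter A B Q Rm gamma).
Local Notation law := (sat_law A B gamma K (T - P)).

Let psd0 : possemidef (0 : 'M[R]_(n + n)).
Proof. by split=> [|x]; rewrite ?trmx0 // qnormE mul0mx dotC dot0l. Qed.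

Lemma Vbar1E x Z : possemidef Z -> Vbar 1 x Z = (saturated_value x Z)%:E.
Proof. by move=> pZ; rewrite -(bellman_sign_value hQ hR pP pM fixP KE TE uD). Qed.

Lemma bellman_congr V1 V2 x Z :
  (forall x Z, possemidef Z -> V1 x Z = V2 x Z :> \bar R) -> possemidef Z ->
  bellman B Q Rm V1 x Z = bellman B Q Rm V2 x Z.
Proof.
move=> h pZ; apply/eqP; rewrite eq_le.
by rewrite !bellman_mono // => x' Z' /h ->.
Qed.

Lemma VbarE k x Z : matrix_condition -> (1 <= k)%N -> possemidef Z ->
  Vbar k x Z = (saturated_value x Z)%:E.
Proof.
move=> hL; case: k => // k _; elim: k x Z => [|k IHk] x Z pZ; first exact: Vbar1E.
rewrite -[LHS]/(bellman B Q Rm (Vbar k.+1) x Z) (bellman_congr _ IHk pZ).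
exact: (bellman_saturated_value hQ hR pP pM fixP KE TE uD uA).
Qed.

Lemma stationary_matrix_condition :
  (forall x Z, possemidef Z -> Vbar 2 x Z = Vbar 1 x Z) -> matrix_condition.
Proof.
move=> h; apply: (saturated_fixpoint_matrix_condition gamma0 hQ hR pP pM fixP
  KE TE uD uA) => x Z pZ.
by rewrite -Vbar1E // -h // -(bellman_congr _ (fun x Z => @Vbar1E x Z) pZ).
Qed.

(** Along the saturated law the control cost to date plus the saturated value
    never increases, and the saturated value is never below minus the
    disturbance energy for either sign. *)
Lemma worst_cost_law x0 : matrix_condition ->
  (worst_cost A B Q Rm gamma law x0 <= (saturated_value x0 0)%:E)%E.
Proof.
move=> hL; apply: ge_ereal_sup => _ [w [i [N [hi ->]]]]; rewrite lee_fin costE //.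
pose x := state A B law x0 i w; pose Z := info A B law x0 i w.
have descent k : control_cost A B Q Rm law x0 i w k
    + saturated_value (x k) (Z k) <= saturated_value x0 0.
  elim: k => [|k IHk]; first by rewrite /control_cost big_geq // add0r.
  apply: le_trans IHk; rewrite /control_cost big_nat_recr //= -addrA lerD2l.
  have := saturated_stage hQ hR pP pM fixP KE TE uD uA (x k) (x k.+1) hL
    (psd_info A B law x0 i w k).
  by rewrite -sat_law_input.
have := descent N.+1; have pZ := psd_info A B law x0 i w N.+1.
have := sign_value_le hQ hR pP pM fixP KE TE uD (x N.+1) pZ.
rewrite -/(Z N.+1) sign_valueE; last by case: pZ.
have := posdef_ge0 (x N.+1) pP.
have : - (i * corr (Z N.+1)) <= `|corr (Z N.+1)|.
  apply: le_trans (ler_norm _) _; rewrite normrN normrM.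
  by case: hi => ->; rewrite ?normrN normr1 mul1r.
by rewrite -mulrA; lra.
Qed.

Lemma worst_cost_pos mu x0 : (0 <= worst_cost A B Q Rm gamma mu x0)%E.
Proof.
apply: le_trans (_ : ((cost A B Q Rm gamma mu x0 (fun=> 0%R) 1 0)%:E <= _)%E).
  rewrite lee_fin /cost big_nat1 enorm2E dot0l mulr0 subr0.
  by rewrite addr_ge0 // posdef_ge0.
by apply: ereal_sup_ubound; exists (fun=> 0), 1, 0%N; split=> //; left.
Qed.

Lemma game_value_fin x0 : matrix_condition ->
  game_value A B Q Rm gamma x0 \is a fin_num.
Proof.
move=> hL; rewrite fin_numElt; apply/andP; split.
  apply: (@lt_le_trans _ _ 0%E); first exact: ltNyr.
  by apply: le_ereal_inf_tmp => _ [mu _ <-]; apply: worst_cost_pos.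
apply: le_lt_trans (ltry (saturated_value x0 0)).
by apply: ge_ereal_inf; eexists; [exists law|apply: worst_cost_law].
Qed.

Lemma V_le_Vbar k x Z : possemidef Z -> (V k x Z <= Vbar k x Z)%E.
Proof.
elim: k x Z => [|k IHk] x Z pZ; last by apply: bellman_mono.
by rewrite lee_fin lerBrDr addNr posdef_ge0.
Qed.

(** Committing to one sign from the start leaves the known-sign game, whose
    value iteration is the Riccati recursion. *)
Lemma V_ge_riccati_iter k x Z : possemidef Z ->
  ((sign_value A gamma (riccati_iter A B Q Rm gamma k) x Z)%:E <= V k x Z)%E.
Proof.
elim: k x Z => [|k IHk] x Z pZ.
  by rewrite lee_fin /sign_value qnormE mul0mx dotC dot0l sub0r.
have [psdk _] := riccati_iter_bounds hQ hR pP pM fixP k.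
have pMk := riccati_iter_gap hQ hR pP pM fixP k.
apply: bellman_ge => u.
have [j hj ej] : exists2 j : R, j = 1 \/ j = -1 & `|corr Z| = j * corr Z.
  case: (ger0P (corr Z)) => _; first by exists 1; [left|rewrite mul1r].
  by exists (-1); [right|rewrite mulN1r].
have [v hv] := sign_bet B Q Rm x u psdk.1 pMk IHk pZ hj.
exists v; apply: le_trans hv; rewrite lee_fin sign_valueE; last by case: pZ.
rewrite ej mulrA lerD2r lerD2r.
exact: (ric_le A B Q hR psdk pMk).
Qed.

(** One Bellman step from the bound [V_ge_riccati_iter]: the function of the
    control that it minimizes is, up to a relative error that tends to zero, the
    one of [bellman_sign_value]. *)
Lemma V_eventually_ge x Z (e : R) : possemidef Z -> 0 < e ->
  (forall e, 0 < e -> exists N, forall k, (N <= k)%N -> forall x,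
    qnorm P x - e * dot x x <= qnorm (riccati_iter A B Q Rm gamma k) x) ->
  exists N, forall k, (N <= k)%N -> ((saturated_value x Z - e)%:E <= V k x Z)%E.
Proof.
move=> pZ e0 cvP; have [C C0 hC] := rcost_continuous A B gamma0 hQ hR pP pM.
have [phi [phi1 _ _ sE]] := saturated_weight hQ hR pP pM fixP KE TE uD x (corr Z).
set s := saturated P T x (corr Z); pose a := `|s| + 2 * `|corr Z|.
have a0 : 0 <= a by rewrite addr_ge0 // mulr_ge0.
(* The tolerance [e / c] makes [r] at most 1, and [r * a] at most [e]. *)
pose c := C * (a + e) + 1; pose r := C * (e / c).
have c0 : 0 < c by rewrite ltr_pwDr // mulr_ge0 // addr_ge0 // ltW.
have rc : r * c = C * e by rewrite /r mulrA divfK // gt_eqF.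
have re : r * (a + e) <= e.
  rewrite -(ler_pM2r c0) (_ : r * (a + e) * c = r * c * (a + e)); last by ring.
  by rewrite rc /c; lra.
have r0 : 0 <= r by rewrite mulr_ge0 // divr_ge0 // ltW.
have r1 : r <= 1 by rewrite -(ler_pM2r e0); have := mulr_ge0 r0 a0; lra.
have [N hN] := cvP (e / c) (divr_gt0 e0 c0).
exists N.+1 => -[//|k] Nk; have {}hN := hN k Nk.
have [psdk _] := riccati_iter_bounds hQ hR pP pM fixP k.
have pMk := riccati_iter_gap hQ hR pP pM fixP k.
apply: bellman_ge => u.
have [j hj le_j] := sign_bet_growth hR pP pM fixP KE TE u phi1 sE.
have [v hv] := sign_bet B Q Rm x u psdk.1 pMk
  (fun x Z => @V_ge_riccati_iter k x Z) pZ hj.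
exists v; apply: le_trans hv; rewrite lee_fin.
rewrite -[saturated_value x Z]/(s - gamma ^+ 2 * energy Z) lerBlDr.
rewrite addrAC lerD2r addrAC -lerBlDr.
have := hC _ _ (ltW (divr_gt0 e0 c0)) psdk.1 pMk hN x (- (j *: u)).
have hs := ler_norm s.
have Gu : 0 <= qnorm (control_weight B Rm gamma P) (u - phi *: (K *m x)).
  by apply/posdef_ge0/(control_weight_posdef B hR (posdef_psd pP) pM).
rewrite -/r => le_r; move: le_j; rewrite -/s => le_j.
have ra : r * (s - 2 * j * corr Z) <= r * a.
  apply: ler_wpM2l => //; rewrite /a; have := ler_norm (- (j * corr Z)).
  by rewrite normrN normrM; case: hj => ->; rewrite ?normrN normr1 mul1r; lra.
have re' : r * a <= e by have := mulr_ge0 r0 (ltW e0); lra.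
move: (rcost A B Q Rm gamma P x _) le_j le_r => b le_j le_r.
have r1' : 0 <= 1 - r by rewrite subr_ge0.
have sb : s - 2 * j * corr Z <= b by lra.
have := ler_wpM2l r1' sb; lra.
Qed.

Lemma law_minimizing :
  (forall e, 0 < e -> exists N, forall k, (N <= k)%N -> forall x,
    qnorm P x - e * dot x x <= qnorm (riccati_iter A B Q Rm gamma k) x) ->
  matrix_condition -> minimizing_law A B Q Rm gamma law.
Proof.
move=> cvP hL x0; apply/eqP; rewrite eq_le; apply/andP; split; last first.
  by apply: ereal_inf_lbound; exists law.
apply: le_ereal_inf_tmp => _ [mu _ <-].
apply: le_trans (worst_cost_law x0 hL) _; apply/lee_addgt0Pr => e e0.
have [N hN] := V_eventually_ge x0 psd0 e0 cvP.
rewrite -leeBlDr // -EFinB; apply: le_trans (hN N.+1 (leqnSn N)) _.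
exact: worst_cost_ge.
Qed.

Lemma V_cvg x Z :
  (forall e, 0 < e -> exists N, forall k, (N <= k)%N -> forall x,
    qnorm P x - e * dot x x <= qnorm (riccati_iter A B Q Rm gamma k) x) ->
  matrix_condition -> possemidef Z ->
  V k x Z @[k --> \oo] --> (saturated_value x Z)%:E.
Proof.
move=> cvP hL pZ.
have ub k : (1 <= k)%N -> (V k x Z <= (saturated_value x Z)%:E)%E.
  by move=> k1; rewrite -(VbarE x hL k1 pZ); apply: V_le_Vbar.
have near_fin e : 0 < e -> \forall k \near \oo, V k x Z \is a fin_num /\
    `|saturated_value x Z - fine (V k x Z)| <= e.
  move=> e0; have [N hN] := V_eventually_ge x pZ e0 cvP.
  exists (maxn N 1) => // k; rewrite /= geq_max => /andP[/hN lo /ub].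
  move: lo; case: (V k x Z) => [r| |]; rewrite ?lee_fin ?leye_eq ?leeNy_eq // => h1 h2.
  by split=> //=; rewrite ler_norml; lra.
apply/fine_cvgP; split; first by apply: filterS (near_fin 1 ltr01) => k [].
by apply/cvgrPdist_le => e e0; apply: filterS (near_fin e e0) => k [].
Qed.

End Value.

(** * The Riccati equation as a fixed point *)

(** The cost is a completed square in the control, so its minimizer is unique. *)
Lemma riccati_fixpoint_gain (R : realType) (n m : nat) (A : 'M[R]_n) (B : 'M[R]_(n, m))
    (Q : 'M[R]_n) (Rm : 'M[R]_m) (gamma : R) (P : 'M[R]_n) (K : 'M[R]_(m, n)) :
  posdef Rm -> posdef P -> posdef (gap gamma P) ->
  riccati A B Q Rm gamma P ->
  (forall x, riccati_max A B Q Rm gamma P x (- (K *m x)) = (qnorm P x)%:E) ->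
  (forall x, qnorm (ric A B Q Rm gamma P) x = qnorm P x) /\
  K = gain A B Rm gamma P.
Proof.
move=> hR pP pM hP hK; have psdP := posdef_psd pP.
have fixP x : qnorm (ric A B Q Rm gamma P) x = qnorm P x.
  by have := hP x; rewrite (ric_inf A B Q hR psdP pM) => -[->].
split=> //; apply/matrixP => i j.
set e : 'cV[R]_n := delta_mx j 0.
have := hK e; rewrite (riccati_maxE _ _ _ _ _ _ psdP.1 pM) => -[].
rewrite (rcostE A B Q hR psdP pM) fixP => h.
have Ge : qnorm (control_weight B Rm gamma P)
    (- (K *m e) + gain A B Rm gamma P *m e) <= 0 by lra.
have := posdef_eq0 (control_weight_posdef B hR psdP pM) Ge.
move=> /eqP; rewrite addrC subr_eq0 => /eqP /matrixP /(_ i 0).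
by rewrite -!colE !mxE.
Qed.

(** * Equivalence, minimizing law and limit of value iteration *)

Theorem theorem3 (R : realType) (n m : nat) (A : 'M[R]_n) (B : 'M[R]_(n, m))
    (Q : 'M[R]_n) (Rm : 'M[R]_m) (gamma : R) (P : 'M[R]_n) (K : 'M[R]_(m, n))
    (T : 'M[R]_n)
    (hQ : posdef Q) (hR : posdef Rm) (hgamma : 0 < gamma)
    (hP : posdef P) (hPgamma : posdef ((gamma ^+ 2)%:M - P))
    (hriccati : riccati A B Q Rm gamma P)
    (hK : forall x : 'cV[R]_n,
        riccati_max A B Q Rm gamma P x (- (K *m x)) = (qnorm P x)%:E)
    (hT : T = Q + A^T *m invmx (invmx P - (gamma ^- 2)%:M) *m A)
    (hA : A \in unitmx) (hTP : T - P \in unitmx) :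
  let cond_i :=
    (forall x0 : 'cV[R]_n, game_value A B Q Rm gamma x0 \is a fin_num) /\
    (forall k : nat, (1 <= k)%N ->
       forall (x : 'cV[R]_n) (Z : 'M[R]_(n + n)), possemidef Z ->
         Vbar_iter A B Q Rm gamma P k x Z = Vbar_iter A B Q Rm gamma P 1 x Z) in
  let cond_ii :=
    forall s : R, s = 1 \/ s = -1 ->
      let L := 1%:M + s *: (B *m K *m invmx A) in
      let M := (gamma ^+ 2)%:M - P in
      possemidef (M *m invmx (T - P) *m M - L *m M *m L^T) in
  (cond_i <-> cond_ii) /\
  (least_riccati A B Q Rm gamma P ->
   cond_i -> cond_ii ->
   minimizing_law A B Q Rm gamma (sat_law A B gamma K (T - P)) /\
   (forall (x : 'cV[R]_n) (Z : 'M[R]_(n + n)), possemidef Z ->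
      let Y := Ymx gamma Z in
      V_iter A B Q Rm gamma k x Z @[k --> \oo] -->
        (if qnorm (T - P) x <= `|mxdot A Y| then
           qnorm P x - gamma ^+ 2 * min_sign A Z
         else
           qnorm T x - gamma ^+ 2 * mxnorm2 Z (block_mx 1%:M 0 0 A)^T
           + mxdot A Y ^+ 2 * (qnorm (T - P) x)^-1)%:E)).
Proof.
have [fixP KE] := riccati_fixpoint_gain _ _ _ _ _ _ _ _ _ _ hR hP hPgamma hriccati hK.
rewrite (supmxE hgamma (posdef_unit hP) (posdef_unit hPgamma)) in hT.
move=> cond_i cond_ii; split; first split.
- case=> _ stat; apply: (stationary_matrix_condition hgamma hQ hR hP hPgamma fixP
    KE hT hTP hA) => x Z pZ.
  exact: stat.
- move=> hL; split=> [x0|k k1 x Z pZ].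
    exact: (game_value_fin hQ hR hP hPgamma fixP KE hT hTP hA).
  by rewrite !(VbarE hQ hR hP hPgamma fixP KE hT hTP hA).
move=> least _ hL.
have [P' [pP' pM' solP' _ cvP']] := riccati_iter_cvg hgamma hQ hR hP hPgamma fixP.
(* The limit of the Riccati iterates is a solution, so it dominates the least
   one, and convergence to it from below is all that the value needs. *)
have cvP e : 0 < e -> exists N, forall k, (N <= k)%N -> forall x,
    qnorm P x - e * dot x x <= qnorm (riccati_iter A B Q Rm gamma k) x.
  move=> e0; have [N hN] := cvP' e e0; exists N => k Nk x.
  apply: le_trans (hN k Nk x); rewrite lerD2r -subr_ge0 -qnormBm.
  by case: (least P' pP' pM' solP').
split; first exact: (law_minimizing hgamma hQ hR hP hPgamma fixP KE hT hTP hA cvP hL).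
move=> x Z pZ Y.
rewrite [if _ then _ else _](_ : _ = saturated_value A gamma P T x Z).
  exact: (V_cvg hgamma hQ hR hP hPgamma fixP KE hT hTP hA cvP hL pZ).
rewrite /saturated_value /saturated -[corr A gamma Z]/(mxdot A Y).
case: ifP => _; last by rewrite addrAC.
by rewrite min_signE ?pZ.1 // -[corr A gamma Z]/(mxdot A Y); ring.
Qed.
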